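(* Let $X$ be a Banach space and suppose that $A,B\in\mathcal L(X)$ are approximately $(\ell_p,\ell_q)$-factorizable operators for some $1<p<q<\infty$ (the same $p,q$ for $A$ and $B$). Then the multiplication operator $L_AR_B\colon\mathcal L(X)\rightarrow\mathcal L(X)$, $L_AR_B(T)=ATB$, is strictly singular.
   Context: $\mathcal L(X)$ denotes the Banach space of bounded linear operators on $X$ with the operator norm. Given $p<q$, an operator $T\in\mathcal L(X)$ is approximately $(\ell_p,\ell_q)$-factorizable if for every $\varepsilon>0$ there exist bounded operators $T_1^\varepsilon\colon X\to\ell_p$, $T_2^\varepsilon\colon\ell_p\to\ell_q$ and $T_3^\varepsilon\colon\ell_q\to X$ such that $\|T-T_3^\varepsilon T_2^\varepsilon T_1^\varepsilon\|\leq\varepsilon$. A bounded operator $S\colon E\to F$ between Banach spaces is strictly singular if for every infinite-dimensional subspace $E_0\subseteq E$ the restriction $S|_{E_0}$ is not an isomorphism onto its range. *)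

(* Defs.v *)
From HB Require Import structures.
From mathcomp Require Import all_boot all_order all_algebra.
From mathcomp Require Import complex.
From mathcomp Require Import all_classical all_reals all_analysis.

Set Implicit Arguments.
Unset Strict Implicit.
Unset Printing Implicit Defensive.
Import Order.TTheory GRing.Theory Num.Theory.
Import numFieldNormedType.Exports.

Local Open Scope classical_set_scope.
Local Open Scope ring_scope.

(* Banach spaces are taken over the reals or over the complex numbers; [kind]
   selects which, so that a single statement covers both cases. *)
Variant kind := RealScalars | ComplexScalars.

Definition sfield (R : realType) (k : kind) : numFieldType :=
  match k with
  | RealScalars => R
  | ComplexScalars => R[i]
  end.

(* The norm of a [normedModType K] takes its values in [K] itself, also when
   [K] is complex.  [toreal] and [ofreal] translate between nonnegative scalars
   and nonnegative real numbers. *)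
Definition toreal {R : realType} {k : kind} : sfield R k -> R :=
  match k return sfield R k -> R with
  | RealScalars => fun x => x
  | ComplexScalars => fun x => complex.Re x
  end.

Definition ofreal {R : realType} {k : kind} : R -> sfield R k :=
  match k return R -> sfield R k with
  | RealScalars => fun x => x
  | ComplexScalars => fun x => real_complex R x
  end.

Definition normR {R : realType} {k : kind} {V : normedModType (sfield R k)}
  (x : V) : R := toreal `|x|.

Section scalar_theory.
Context {R : realType} {k : kind}.
Local Notation K := (sfield R k).

Lemma ofrealK : cancel (@ofreal R k) toreal.
Proof. by case: k. Qed.

Lemma torealK (z : K) : 0 <= z -> ofreal (toreal z) = z.
Proof.
case: k z => //= z z0; apply: RRe_real; exact: ger0_real.
Qed.

Lemma ofreal0 : ofreal 0 = 0 :> K.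
Proof. by case: k. Qed.

Lemma ofreal1 : ofreal 1 = 1 :> K.
Proof. by case: k. Qed.

Lemma ofrealD (x y : R) : ofreal (x + y) = ofreal x + ofreal y :> K.
Proof. by case: k => //=; rewrite rmorphD. Qed.

Lemma ofrealM (x y : R) : ofreal (x * y) = ofreal x * ofreal y :> K.
Proof. by case: k => //=; rewrite rmorphM. Qed.

Lemma ler_ofreal (x y : R) : (ofreal x <= ofreal y :> K) = (x <= y).
Proof. by case: k => //=; rewrite lecR. Qed.

Lemma ltr_ofreal (x y : R) : (ofreal x < ofreal y :> K) = (x < y).
Proof. by case: k => //=; rewrite ltcR. Qed.

Context {V : normedModType K}.
Implicit Types x y : V.

Lemma ofreal_normR x : ofreal (normR x) = `|x|.
Proof. by rewrite torealK. Qed.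

Lemma normR_ge0 x : 0 <= normR x.
Proof. by rewrite -ler_ofreal ofreal_normR ofreal0. Qed.

Lemma ler_normRD x y : normR (x + y) <= normR x + normR y.
Proof. by rewrite -ler_ofreal ofrealD !ofreal_normR ler_normD. Qed.

Lemma normRN x : normR (- x) = normR x.
Proof. by rewrite /normR normrN. Qed.

Lemma normR0 : normR (0 : V) = 0.
Proof. by rewrite /normR normr0 -ofreal0 ofrealK. Qed.

Lemma normR0_eq0 x : normR x = 0 -> x = 0.
Proof.
by move=> x0; apply: normr0_eq0; rewrite -ofreal_normR x0 ofreal0.
Qed.

Lemma normRZ (a : K) x : normR (a *: x) = toreal `|a| * normR x.
Proof.
by rewrite /normR normrZ -[RHS]ofrealK ofrealM !torealK// ?normr_ge0.
Qed.

End scalar_theory.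

Definition bounded_operator {R : realType} {k : kind}
    {E F : normedModType (sfield R k)} (f : E -> F) : Prop :=
  linear f /\ exists M : R, forall x : E, normR (f x) <= M * normR x.

Definition bounded_operator_pred {R : realType} {k : kind}
    (E F : normedModType (sfield R k)) : {pred E -> F} :=
  fun f => `[< bounded_operator f >].
Arguments bounded_operator_pred {R k} E F _.

Record bop {R : realType} {k : kind} (E F : normedModType (sfield R k)) := Bop {
  bop_fun :> E -> F ;
  _ : bop_fun \in bounded_operator_pred E F
}.

Section bop_lmodule.
Context {R : realType} {k : kind} (E F : normedModType (sfield R k)).
Local Notation K := (sfield R k).

Lemma bounded_operator_submod_closed :
  submod_closed (bounded_operator_pred E F).
Proof.
split.
  apply/asboolP; split; first by move=> a u v /=; rewrite scaler0 addr0.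
  by exists 0 => x; rewrite mul0r normR0.
move=> a f g /asboolP[lf [M fM]] /asboolP[lg [N gN]]; apply/asboolP; split.
  move=> b u v; rewrite !fctE lf lg !scalerDr !scalerA mulrC.
  by rewrite -!addrA; congr (_ + _); rewrite addrCA.
exists (toreal `|a| * M + N) => x; rewrite !fctE.
rewrite (le_trans (ler_normRD _ _))// normRZ mulrDl lerD// -mulrA.
by rewrite ler_wpM2l// -(@ler_ofreal _ k) torealK// ofreal0.
Qed.

HB.instance Definition _ := [isSub for @bop_fun R k E F].
HB.instance Definition _ := [Choice of bop E F by <:].
HB.instance Definition _ := GRing.isSubmodClosed.Build K (E -> F)
  (bounded_operator_pred E F) bounded_operator_submod_closed.
HB.instance Definition _ := [SubChoice_isSubLmodule of bop E F by <:].

Lemma bop_linear (T : bop E F) : linear T.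
Proof. by case: T => f /= /asboolP[]. Qed.

HB.instance Definition _ (T : bop E F) :=
  GRing.isLinear.Build K E F *:%R T (bop_linear T).

Lemma bop_bounded (T : bop E F) :
  exists2 M : R, 0 <= M & forall x, normR (T x) <= M * normR x.
Proof.
case: T => f /= /asboolP[_ [M fM]]; exists `|M| => // x.
by rewrite (le_trans (fM x))// ler_wpM2r ?normR_ge0// ler_norm.
Qed.

Lemma bopP (S T : bop E F) : (forall x, S x = T x) -> S = T.
Proof. by move=> ST; apply/val_inj/funext. Qed.

Implicit Types (S T : bop E F) (x : E) (M : R).

Definition opnormR (T : bop E F) : R :=
  sup [set normR (T x) | x in [set x : E | `|x| <= 1]].

Lemma opnormR_has_sup (T : bop E F) :
  has_sup [set normR (T x) | x in [set x : E | `|x| <= 1]].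
Proof.
split; first by exists (normR (T 0)), 0 => //=; rewrite normr0.
have [M M0 TM] := bop_bounded T; exists M => _ [x /= x1 <-].
rewrite (le_trans (TM x))// ler_piMr// -(@ler_ofreal _ k) ofreal_normR.
by rewrite ofreal1.
Qed.

Lemma opnormR_ge0 T : 0 <= opnormR T.
Proof.
apply: le_trans (ub_le_sup (opnormR_has_sup T).2 _); last first.
  by exists 0 => //=; rewrite normr0.
exact: normR_ge0.
Qed.

Lemma ler_opnormR T x : normR (T x) <= opnormR T * normR x.
Proof.
have [->|x0] := eqVneq x 0; first by rewrite raddf0 !normR0 mulr0.
have nx0 : 0 < normR x.
  by rewrite lt_neqAle normR_ge0 andbT eq_sym; apply: contra_neq x0 => /normR0_eq0.
rewrite -ler_pdivrMr//.
have yE : normR (T (`|x|^-1 *: x)) = normR (T x) / normR x.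
  rewrite linearZ normRZ mulrC; congr (_ * _).
  apply: (mulIf (lt0r_neq0 nx0)); rewrite mulVf ?lt0r_neq0//.
  rewrite -normRZ /normR normrZ normfV normr_id mulVf ?normr_eq0//.
  by rewrite -(@ofreal1 _ k) ofrealK.
rewrite -yE; apply: ub_le_sup; first exact: (opnormR_has_sup T).2.
exists (`|x|^-1 *: x) => //=.
by rewrite normrZ normfV normr_id mulVf ?normr_eq0.
Qed.

Lemma opnormR_le T M : 0 <= M -> (forall x, normR (T x) <= M * normR x) ->
  opnormR T <= M.
Proof.
move=> M0 TM; apply: ge_sup; first exact: (opnormR_has_sup T).1.
move=> _ [x /= x1 <-]; rewrite (le_trans (TM x))// ler_piMr//.
by rewrite -(@ler_ofreal _ k) ofreal_normR ofreal1.
Qed.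

Definition opnorm (T : bop E F) : K := ofreal (opnormR T).

Lemma opnormD S T : opnorm (S + T) <= opnorm S + opnorm T.
Proof.
rewrite /opnorm -ofrealD ler_ofreal.
apply: opnormR_le => [|x]; first by rewrite addr_ge0 ?opnormR_ge0.
by rewrite (le_trans (ler_normRD _ _))// mulrDl lerD// ler_opnormR.
Qed.

Lemma opnormZ_le (a : K) T : opnormR (a *: T) <= toreal `|a| * opnormR T.
Proof.
have a0 : 0 <= toreal `|a| by rewrite -(@ler_ofreal _ k) torealK// ofreal0.
apply: opnormR_le => [|x]; first by rewrite mulr_ge0// opnormR_ge0.
by rewrite normRZ -mulrA ler_wpM2l// ler_opnormR.
Qed.

Lemma opnormZ (a : K) T : opnorm (a *: T) = `|a| * opnorm T.
Proof.
rewrite /opnorm -[in RHS](torealK (normr_ge0 a)) -ofrealM; congr ofreal.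
apply/eqP; rewrite eq_le opnormZ_le/=.
have [->|a0] := eqVneq a 0.
  by rewrite normr0 -(@ofreal0 _ k) ofrealK mul0r opnormR_ge0.
have na0 : 0 < toreal `|a|.
  by rewrite -(@ltr_ofreal _ k) torealK// ofreal0 normr_gt0.
rewrite mulrC -ler_pdivlMr//.
rewrite -[in leLHS](scale1r T) -(mulVf a0) -scalerA.
rewrite (le_trans (opnormZ_le _ _))// mulrC ler_wpM2l ?opnormR_ge0//.
rewrite -(@ler_ofreal _ k) torealK//.
suff -> : ofreal (toreal `|a|)^-1 = `|a^-1| :> K by [].
rewrite normfV; apply: (mulfI (x := `|a|)); first by rewrite normr_eq0.
rewrite mulfV ?normr_eq0// -[X in X * _]torealK// -ofrealM mulfV ?ofreal1//.
exact: lt0r_neq0.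
Qed.

Lemma opnorm0_eq0 T : opnorm T = 0 -> T = 0.
Proof.
rewrite /opnorm -(@ofreal0 _ k) => /(can_inj ofrealK) T0.
apply: bopP => x; apply/normR0_eq0/eqP; rewrite eq_le normR_ge0 andbT.
by rewrite (le_trans (ler_opnormR T x))// T0 mul0r.
Qed.

HB.instance Definition _ :=
  Lmodule_isNormed.Build K (bop E F) opnormD opnormZ opnorm0_eq0.

Lemma normR_bopE (T : bop E F) : normR T = opnormR T.
Proof. exact: ofrealK. Qed.

End bop_lmodule.

Section bop_complete.
Context {R : realType} {k : kind}.
Local Notation K := (sfield R k).

Lemma ler_norm_bop {E F : normedModType K} (T : bop E F) (x : E) :
  `|T x| <= `|T| * `|x|.
Proof.
by rewrite -!ofreal_normR -ofrealM ler_ofreal normR_bopE ler_opnormR.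
Qed.

Lemma norm_bop_le {E F : normedModType K} (T : bop E F) (M : K) : 0 <= M ->
  (forall x, `|T x| <= M * `|x|) -> `|T| <= M.
Proof.
move=> M0 TM; rewrite -ofreal_normR -(torealK M0) ler_ofreal normR_bopE.
apply: opnormR_le => [|x]; first by rewrite -(@ler_ofreal _ k) torealK// ofreal0.
by rewrite -(@ler_ofreal _ k) ofrealM torealK// !ofreal_normR.
Qed.

Context (E : normedModType K) (F : completeNormedModType K).

Lemma bop_complete (G : set_system (bop E F)) :
  ProperFilter G -> cauchy G -> cvg G.
Proof.
move=> PG /cauchyP cG.
have cGE e : 0 < e -> exists S, \forall T \near G, `|S - T| < e.
  by move=> e0; have [S] := cG e e0; rewrite -ball_normE; exists S.
have cvG x : cvg ((fun T : bop E F => T x) @ G).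
  apply: cauchy_cvg; apply/cauchyP => e e0.
  have d0 : 0 < `|x| + 1 by rewrite ltr_wpDl.
  have [S ST] := cGE _ (divr_gt0 e0 d0); exists (S x).
  rewrite -ball_normE; apply: filterS ST => T /= ST.
  have -> : S x - T x = (S - T) x by [].
  rewrite (le_lt_trans (ler_norm_bop _ _))//.
  rewrite (@le_lt_trans _ _ (e / (`|x| + 1) * `|x|)) ?ler_wpM2r ?(ltW ST)//.
  by rewrite mulrAC ltr_pdivrMr// ltr_pM2l// ltrDl.
pose g x := lim ((fun T : bop E F => T x) @ G).
have gP x : (fun T : bop E F => T x) @ G --> g x by exact: cvG.
have glin : linear g.
  move=> a u v; apply: (@cvg_unique _ (@norm_hausdorff _ F) _ _ _ _ (gP _)).
  rewrite (_ : (fun _ => _) = (fun T : bop E F => a *: T u + T v)).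
    by apply: cvgD => //; exact: cvgZr.
  by apply/funext => T; rewrite linearP.
have Sg S e : 0 < e -> (\forall T \near G, `|S - T| < e) ->
    forall x, `|S x - g x| <= e * `|x|.
  move=> e0 ST x; apply/ler_addgt0Pr => d d0.
  have : G [set T : bop E F | `|g x - T x| < d].
    by have /cvgrPdist_lt/(_ d d0) := gP x.
  move=> /(filterI ST)/filter_ex[T [/= {}ST gT]].
  rewrite -(subrKA (T x)) (le_trans (ler_normD _ _))// lerD//; last first.
    by rewrite distrC ltW.
  have -> : S x - T x = (S - T) x by [].
  by rewrite (le_trans (ler_norm_bop _ _))// ler_wpM2r// ltW.
have gb : g \in bounded_operator_pred E F.
  apply/asboolP; split => //; have [S ST] := cGE _ (@ltr01 K).
  exists (1 + normR S) => x; rewrite -(@ler_ofreal _ k) ofrealM ofrealD.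
  rewrite ofreal1 !ofreal_normR -[g x](subKr (S x)).
  rewrite (le_trans (ler_normB _ _))// addrC mulrDl lerD//.
    exact: Sg ST x.
  exact: ler_norm_bop.
apply/cvg_ex; exists (Bop gb); apply/cvgrPdist_lt => e e0.
have e20 : 0 < e / 2 by rewrite divr_gt0.
have [S ST] := cGE _ e20.
apply: filterS (ST) => T {}ST'; rewrite (splitr e) -(subrKA S).
rewrite (le_lt_trans (ler_normD _ _))// ler_ltD// distrC.
by apply: norm_bop_le => [|x]; [exact: ltW|exact: Sg].
Qed.

HB.instance Definition _ := Uniform_isComplete.Build (bop E F) bop_complete.

End bop_complete.

(* Locked, to keep unification from unfolding the series. *)
HB.lock Definition lp_sum {R : realType} {k : kind} (p : R)
    (x : nat -> (sfield R k)^o) : \bar R :=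
  (\sum_(0 <= n <oo) (toreal `|x n| `^ p)%:E)%E.
Canonical locked_lp_sum := Unlockable lp_sum.unlock.

Section lp_sum_theory.
Context {R : realType} {k : kind}.
Local Notation K := (sfield R k).
Implicit Types (p : R) (x y : nat -> K^o).

Definition lp_norm p x : R := fine (lp_sum p x) `^ p^-1.

Lemma toreal_norm_ge0 (z : K) : 0 <= toreal `|z|.
Proof. by rewrite -(@ler_ofreal _ k) torealK// ofreal0. Qed.

Lemma lp_sum_ge0 p x : (0 <= lp_sum p x)%E.
Proof.
by rewrite unlock; apply: nneseries_ge0 => n _ _; rewrite lee_fin powR_ge0.
Qed.

Lemma lp_sum_Lnorm p (a : nat -> R) : (forall n, 0 <= a n) ->
  ('N[@counting nat R]_p%:E[EFin \o a] =
   (\sum_(0 <= n <oo) (a n `^ p)%:E) `^ p^-1)%E.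
Proof.
move=> a0; rewrite unlock /= ge0_integral_count => [|n]; last first.
  by rewrite lee_fin powR_ge0.
congr (_ `^ _)%E; apply: eq_eseriesr => n _ /=.
by rewrite ger0_norm.
Qed.

Lemma lp_sumD p x y : 1 <= p ->
  (lp_sum p (x + y)%R `^ p^-1 <= lp_sum p x `^ p^-1 + lp_sum p y `^ p^-1)%E.
Proof.
move=> p1; have p0 : 0 <= p by rewrite (le_trans ler01).
pose a z n := toreal `|(z : nat -> K^o) n|.
have LE z : (lp_sum p z `^ p^-1 = 'N[@counting nat R]_p%:E[EFin \o a z])%E.
  by rewrite unlock lp_sum_Lnorm// => n; exact: toreal_norm_ge0.
rewrite (LE x) (LE y); apply: le_trans (minkowski_EFin _ _ _ p1) => //.
rewrite lp_sum_Lnorm => [|n]; last by rewrite addr_ge0 ?toreal_norm_ge0.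
have s0 (f : nat -> R) : (0 <= \sum_(0 <= n <oo) (f n `^ p)%:E)%E.
  by apply: nneseries_ge0 => n _ _; rewrite lee_fin powR_ge0.
have I (t : \bar R) : (0 <= t)%E -> t \in `[0%E, +oo%E].
  by move=> t0; rewrite in_itv/= t0 leey.
apply: gt0_ler_poweR; [by rewrite invr_ge0|exact/I/lp_sum_ge0|exact/I/s0|].
rewrite lp_sum.unlock; apply: lee_nneseries => n _; first by rewrite lee_fin powR_ge0.
rewrite lee_fin ge0_ler_powR ?nnegrE ?toreal_norm_ge0//.
  by rewrite addr_ge0 ?toreal_norm_ge0.
by rewrite -(@ler_ofreal _ k) ofrealD !torealK// ler_normD.
Qed.

Lemma lp_sumZ p (a : K) x :
  lp_sum p (a *: x) = ((toreal `|a| `^ p)%:E * lp_sum p x)%E.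
Proof.
rewrite lp_sum.unlock -nneseriesZl => [|n _]; last by rewrite lee_fin powR_ge0.
apply: eq_eseriesr => n _; rewrite -EFinM -powRM ?toreal_norm_ge0//.
congr (_ `^ _)%:E; rewrite -[RHS](@ofrealK _ k) ofrealM !torealK//.
by rewrite -normrM.
Qed.

Lemma lp_sum0 p : 0 < p -> lp_sum p (0 : nat -> K^o) = 0%E.
Proof.
move=> p0; rewrite unlock; apply: eseries0 => n _ _.
by rewrite normr0 -(@ofreal0 _ k) ofrealK powR0// gt_eqF.
Qed.

Lemma lp_sum_eq0 p x : 0 < p -> lp_sum p x = 0%E -> x = 0.
Proof.
move=> p0 x0; apply/funext => n; apply/normr0_eq0.
have f0 i : (0 <= (toreal `|x i| `^ p)%:E)%E by rewrite lee_fin powR_ge0.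
have : ((toreal `|x n| `^ p)%:E <= 0)%E.
  rewrite -x0 lp_sum.unlock (nneseriesD1 (n := n))// leeDl//.
  exact: nneseries_ge0.
rewrite lee_fin => xn; have /powR_eq0_eq0 xn0 : toreal `|x n| `^ p = 0.
  by apply/eqP; rewrite eq_le xn powR_ge0.
by rewrite -[LHS]torealK ?normr_ge0// xn0 ofreal0.
Qed.

Definition lp_pred (p : R) : {pred nat -> K^o} :=
  fun x => `[< (lp_sum p x < +oo)%E >].

End lp_sum_theory.
Arguments lp_pred {R} k p _.

Record lp {R : realType} (k : kind) (p : R) (p1 : 1 <= p) := Lp {
  lp_seq :> nat -> (sfield R k)^o ;
  _ : lp_seq \in lp_pred k p
}.

Section lp_lmodule.
Context {R : realType} (k : kind) (p : R) (p1 : 1 <= p).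
Local Notation K := (sfield R k).

Let p0 : 0 < p. Proof. exact: lt_le_trans p1. Qed.

Lemma lp_submod_closed : submod_closed (lp_pred k p).
Proof.
split=> [|a x y /asboolP xoo /asboolP yoo]; apply/asboolP.
  by rewrite lp_sum0.
apply: (@lty_poweRy _ _ p^-1); first by rewrite invr_neq0// gt_eqF.
apply: (le_lt_trans (lp_sumD _ _ p1)).
by rewrite lte_add_pinfty// poweR_lty// lp_sumZ lte_mul_pinfty// lee_fin powR_ge0.
Qed.

HB.instance Definition _ := [isSub for @lp_seq R k p p1].
HB.instance Definition _ := [Choice of lp k p1 by <:].
HB.instance Definition _ := GRing.isSubmodClosed.Build K (nat -> K^o)
  (lp_pred k p) lp_submod_closed.
HB.instance Definition _ := [SubChoice_isSubLmodule of lp k p1 by <:].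

Implicit Types x y : lp k p1.

Lemma lp_sum_fin x : lp_sum p x \is a fin_num.
Proof.
by case: x => x /= /asboolP xoo; rewrite ge0_fin_numE// lp_sum_ge0.
Qed.

Lemma lp_norm_EFin x : (lp_norm p x)%:E = (lp_sum p x `^ p^-1)%E.
Proof. by rewrite -[in RHS](fineK (lp_sum_fin x)) poweR_EFin. Qed.

Definition lp_knorm x : K := ofreal (lp_norm p x).

Lemma lp_knormD x y : lp_knorm (x + y) <= lp_knorm x + lp_knorm y.
Proof.
rewrite /lp_knorm -ofrealD ler_ofreal -lee_fin EFinD.
rewrite (lp_norm_EFin (x + y)) (lp_norm_EFin x) (lp_norm_EFin y).
exact: (lp_sumD (lp_seq x) (lp_seq y) p1).
Qed.

Lemma lp_knormZ (a : K) x : lp_knorm (a *: x) = `|a| * lp_knorm x.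
Proof.
rewrite /lp_knorm -[in RHS](torealK (normr_ge0 a)) -ofrealM; congr ofreal.
rewrite /lp_norm.
have -> : lp_sum p (a *: x) = ((toreal `|a| `^ p)%:E * lp_sum p x)%E.
  exact: (lp_sumZ p a (lp_seq x)).
rewrite fineM ?lp_sum_fin//= powRM ?powR_ge0 ?fine_ge0 ?lp_sum_ge0//.
by rewrite -powRrM mulfV ?gt_eqF// powRr1 ?toreal_norm_ge0.
Qed.

Lemma lp_knorm_eq0 x : lp_knorm x = 0 -> x = 0.
Proof.
rewrite /lp_knorm -(@ofreal0 _ k) => /(can_inj ofrealK)/powR_eq0_eq0 x0.
apply/val_inj/(lp_sum_eq0 p0).
by rewrite -[LHS](fineK (lp_sum_fin x)) x0.
Qed.

HB.instance Definition _ :=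
  Lmodule_isNormed.Build K (lp k p1) lp_knormD lp_knormZ lp_knorm_eq0.

Lemma normR_lpE x : normR x = lp_norm p x.
Proof. exact: ofrealK. Qed.

End lp_lmodule.

Section bop_composition.
Context {R : realType} {k : kind}.
Local Notation K := (sfield R k).

Lemma bcomp_subproof {E F G : normedModType K} (S : bop F G) (T : bop E F) :
  S \o T \in bounded_operator_pred E G.
Proof.
apply/asboolP; split; first by move=> a u v; rewrite /= !linearP.
exists (opnormR S * opnormR T) => x /=.
by rewrite (le_trans (ler_opnormR S _))// -mulrA ler_wpM2l ?opnormR_ge0// ler_opnormR.
Qed.

Definition bcomp {E F G : normedModType K} (S : bop F G) (T : bop E F) :
  bop E G := Bop (bcomp_subproof S T).

Lemma mulop_subproof {X : normedModType K} (A B : bop X X) :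
  (fun T : bop X X => bcomp A (bcomp T B)) \in
  bounded_operator_pred (bop X X) (bop X X).
Proof.
apply/asboolP; split.
  by move=> a S T; apply: bopP => x /=; rewrite linearP.
exists (opnormR A * opnormR B) => T; rewrite !normR_bopE.
apply: opnormR_le => [|x /=].
  by rewrite !mulr_ge0 ?opnormR_ge0.
rewrite (le_trans (ler_opnormR A _))// -!mulrA ler_wpM2l ?opnormR_ge0//.
rewrite (le_trans (ler_opnormR T _))// mulrCA ler_wpM2l ?opnormR_ge0//.
exact: ler_opnormR.
Qed.

Definition mulop {X : normedModType K} (A B : bop X X) :
  bop (bop X X) (bop X X) := Bop (mulop_subproof A B).

End bop_composition.

Section singular_factorizable.
Context {R : realType} {k : kind}.
Local Notation K := (sfield R k).

Definition approx_factorizable (p q : R) (p1 : 1 <= p) (pq : p < q)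
    {X : completeNormedModType K} (T : bop X X) : Prop :=
  forall e : R, 0 < e ->
    exists (T1 : bop X (lp k p1))
           (T2 : bop (lp k p1) (lp k (le_trans p1 (ltW pq))))
           (T3 : bop (lp k (le_trans p1 (ltW pq))) X),
      normR (T - bcomp T3 (bcomp T2 T1)) <= e.

Definition linear_subspace {E : lmodType K} (V : set E) : Prop :=
  submod_closed [in V].

Definition finite_dimensional {E : lmodType K} (V : set E) : Prop :=
  exists (n : nat) (b : 'I_n -> E), (forall i, V (b i)) /\
    forall v, V v -> exists c : 'I_n -> K, v = \sum_(i < n) c i *: b i.

(* [S], being bounded, is linear and continuous; the inverse [g] of its
   restriction to [V] is then automatically linear on the range [S @` V]. *)
Definition isomorphism_onto_range {E F : normedModType K} (S : bop E F)
    (V : set E) : Prop :=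
  exists g : F -> E,
    (forall x, V x -> g (S x) = x) /\ {within S @` V, continuous g}.

Definition strictly_singular {E F : completeNormedModType K} (S : bop E F) :
    Prop :=
  forall V : set E, linear_subspace V -> ~ finite_dimensional V ->
    ~ isomorphism_onto_range S V.

End singular_factorizable.

(* Main.v *)
(* A factorization of A and B through ell_p -> ell_q reduces the theorem to the
   following: if A, B : ell_p -> ell_q are bounded, no infinite-dimensional
   space W of operators S : ell_q -> ell_p satisfies e |S| <= |A S B|.  By
   Pitt's theorem each S, and hence each T = A S B, is a norm limit of its
   finite corners P_n S P_n, while S in W can be chosen on the unit sphere with
   P_n S P_n = 0 and P_n T P_n = 0.  A gliding hump thus gives S_i in W and
   levels n_i such that S_i and T_i live, up to a small error, in the L-shaped
   region between the corners n_i and n_(i+1).  For the sum over i < N: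
   - |sum T_i| is at most of order 1 + N^(1/q) + N^(1-1/p), the last two terms
     coming from the rows and the columns of the L-shapes;
   - |sum S_i| is at least of order N^(1/p) if some column of the S_i does not
     vanish asymptotically, N^(1-1/q) if some row does not, and N^(1/p-1/q) in
     all cases in which the S_i are nearly block diagonal.
   If the columns of the S_i vanish asymptotically, the term N^(1/q) disappears
   from the upper bound, and if the rows do, N^(1-1/p) does.  As 1/q < 1/p, the
   lower bound beats the upper one in each case. *)
From HB Require Import structures.
Require Import Defs.
From mathcomp Require Import all_boot all_order all_algebra.
From mathcomp Require Import all_classical all_reals all_analysis.
From mathcomp Require Import ring lra.
Set Implicit Arguments.
Unset Strict Implicit.
Unset Printing Implicit Defensive.
Import Order.TTheory GRing.Theory Num.Theory.
Import numFieldNormedType.Exports.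
Local Open Scope classical_set_scope.
Local Open Scope ring_scope.

(** * Powers *)

Section powers.
Context {R : realType}.
Implicit Types (p q x y : R).

Lemma powRVK p x : 0 < p -> 0 <= x -> (x `^ p^-1) `^ p = x.
Proof. by move=> p0 x0; rewrite -powRrM mulVf ?gt_eqF// powRr1. Qed.

Lemma ltr_powR_growth (c D l m : R) : 0 < c -> m < l ->
  ~ (forall N : nat, (0 < N)%N -> c * N%:R `^ l <= D * N%:R `^ m).
Proof.
move=> c0 ml H.
have a0 : 0 < l - m by rewrite subr_gt0.
pose M := Num.max 1 (D / c).
have M1 : 1 <= M by rewrite le_max lexx.
pose N := (Num.truncn (M `^ (l - m)^-1)).+1.
have MN : M `^ (l - m)^-1 < N%:R by apply: truncnS_gt.
have N0 : 0 < N%:R :> R by rewrite ltr0n.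
have := H N isT.
rewrite -[l in _ `^ l](subrK m) powRD ?(gt_eqF N0) ?implybT//.
rewrite mulrA ler_pM2r ?powR_gt0// mulrC -ler_pdivlMr// leNgt => /negP; apply.
apply: (@le_lt_trans _ _ M); first by rewrite le_max lexx orbT.
have -> : M = (M `^ (l - m)^-1) `^ (l - m) by rewrite powRVK// (le_trans ler01).
by apply: gt0_ltr_powR => //; rewrite nnegrE ?powR_ge0.
Qed.

Lemma ler_of_powR p x y : 0 < p -> 0 <= x -> 0 <= y ->
  x `^ p <= y `^ p -> x <= y.
Proof.
move=> p0 x0 y0; apply: contraTT; rewrite -!ltNge => yx.
exact: gt0_ltr_powR.
Qed.

(* Hoelder's inequality up to a factor 2, from [b <= 1 + b `^ p]. *)
Lemma sum_le_of_sum_powR p (M : R) (N : nat) (a : nat -> R) :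
  1 < p -> (0 < N)%N -> 0 <= M -> (forall k, 0 <= a k) ->
  \sum_(k < N) a k `^ p <= M `^ p ->
  \sum_(k < N) a k <= 2 * M * N%:R `^ (1 - p^-1).
Proof.
move=> p1 N0 M0 a0 aM.
have p0 : 0 < p by rewrite (lt_trans _ p1).
have RN0 : 0 < N%:R :> R by rewrite ltr0n.
have [M00|Mn0] := eqVneq M 0.
  have z k : (k < N)%N -> a k = 0.
    move=> kN; have : a k `^ p <= 0.
      rewrite (le_trans _ (le_trans aM _)) ?M00 ?powR0 ?gt_eqF//.
      by rewrite (bigD1 (Ordinal kN))//= lerDl sumr_ge0// => i _; rewrite powR_ge0.
    by move=> h; apply: (@powR_eq0_eq0 _ _ p); apply/eqP; rewrite eq_le h powR_ge0.
  by rewrite big1 ?M00 ?mulr0 ?mul0r// => i _; exact: z.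
have Mp : 0 < M by rewrite lt_neqAle eq_sym Mn0.
(* [t] is the common value of [N] equal numbers whose p-th powers add up to M^p. *)
pose t := M * N%:R `^ (- p^-1).
have t0 : 0 < t by rewrite mulr_gt0// powR_gt0.
have tN : t * N%:R = M * N%:R `^ (1 - p^-1).
  rewrite /t -mulrA -[X in _ * (_ * X)]powRr1 ?ltW// -powRD ?(gt_eqF RN0) ?implybT//.
  by rewrite addrC.
have tp : t `^ p * N%:R = M `^ p.
  rewrite /t powRM ?ltW// ?powR_gt0// -powRrM mulNr mulVf ?gt_eqF//.
  by rewrite powRN powRr1 ?ltW// -mulrA mulVf ?mulr1 ?gt_eqF.
have key k : a k <= t + t * (a k / t) `^ p.
  set b := a k / t; have -> : a k = t * b by rewrite mulrC divfK// gt_eqF.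
  have b0 : 0 <= b by rewrite divr_ge0// ltW.
  rewrite -[X in X + _]mulr1 -mulrDr ler_pM2l//.
  have [b1|b1] := leP b 1; first by rewrite (le_trans b1)// lerDl powR_ge0.
  by rewrite (le_trans (le1r_powR (ltW b1) (ltW p1)))// lerDr.
apply: (@le_trans _ _ (\sum_(k < N) (t + t * (a k / t) `^ p))).
  by apply: ler_sum.
rewrite big_split/= sumr_const card_ord -mulr_sumr -mulrA -tN mulr2n mulrDl mul1r.
rewrite -[X in X + _]mulr_natr lerD2l ler_pM2l//.
under eq_bigr do rewrite powRM// ?invr_ge0 ?ltW//.
have -> : t^-1 `^ p = (t `^ p)^-1.
  by rewrite -(powR_inv1 (ltW t0)) -powRrM mulN1r powRN.
rewrite -mulr_suml.
by rewrite ler_pdivrMr ?powR_gt0// mulrC tp.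
Qed.

(** Every term is at most [M], so a^q = a^p a^(q - p) <= a^p M^(q - p). This is the contractive
    inclusion of ell_p into ell_q for finite sums. *)
Lemma sum_powR_le_of_le p q (M : R) (N : nat) (a : nat -> R) :
  0 < p -> p <= q -> 0 <= M -> (forall k, 0 <= a k) ->
  \sum_(k < N) a k `^ p <= M `^ p ->
  \sum_(k < N) a k `^ q <= M `^ q.
Proof.
move=> p0 pq M0 a0 aM.
have aM' k : (k < N)%N -> a k <= M.
  move=> kN; apply: (@ler_of_powR p) => //; apply: le_trans aM.
  by rewrite (bigD1 (Ordinal kN))//= lerDl sumr_ge0// => i _; rewrite powR_ge0.
have e x : 0 <= x -> x `^ q = x `^ p * x `^ (q - p).
  move=> x0; rewrite -powRD addrC subrK//.
  by rewrite gt_eqF// (lt_le_trans p0).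
rewrite e// (@le_trans _ _ ((\sum_(k < N) a k `^ p) * M `^ (q - p)))//.
  rewrite mulr_suml ler_sum// => k _; rewrite e// ler_wpM2l ?powR_ge0//.
  by rewrite ge0_ler_powR ?nnegrE ?subr_ge0// aM'.
by rewrite ler_wpM2r ?powR_ge0.
Qed.

End powers.

(** * Spaces with coordinates *)

Section coord_system.
Context {R : realType} {k : kind}.
Local Notation K := (sfield R k).

(* An abstract stand-in for [lp], with unit vectors [cvec] and coordinate
   functionals [ccoef]; it carries everything the argument uses. *)
Record coord_system (p : R) (E : normedModType K) := CoordSystem {
  cvec : nat -> E ;
  ccoef : nat -> {linear E -> K^o} ;
  ccoef_cvec : forall i j, ccoef i (cvec j) = (i == j)%:R ;
  normR_cvec : forall i, normR (cvec i) <= 1 ;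
  normR_ccoef : forall i x, normR (ccoef i x) <= normR x ;
  powR_norm_split : forall n x, normR x `^ p =
    normR (\sum_(i < n) ccoef i x *: cvec i) `^ p +
    normR (x - \sum_(i < n) ccoef i x *: cvec i) `^ p ;
  csum_cvg : forall x (e : R), 0 < e -> exists n0, forall n, (n0 <= n)%N ->
    normR (x - \sum_(i < n) ccoef i x *: cvec i) <= e
}.

Context {E : normedModType K} {p : R} (c : coord_system p E).
Implicit Types (x y : E) (m n : nat).

Definition trunc n x : E := \sum_(i < n) ccoef c i x *: cvec c i.

Lemma trunc_is_linear n : linear (trunc n).
Proof.
move=> a x y; rewrite /trunc scaler_sumr -big_split/=; apply: eq_bigr => i _.
by rewrite linearP scalerDl scalerA.
Qed.

HB.instance Definition _ n :=
  GRing.isLinear.Build K E E *:%R (trunc n) (trunc_is_linear n).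

Lemma ccoef_trunc n x (i : nat) : ccoef c i (trunc n x) =
  if (i < n)%N then ccoef c i x else 0.
Proof.
rewrite /trunc linear_sum/=.
have [lin|nin] := ltnP i n.
  rewrite (bigD1 (Ordinal lin))//= linearZ/= ccoef_cvec eqxx.
  rewrite big1 ?addr0 => [|j ji]; first by rewrite [LHS]mulr1.
  have /negbTE ij : i != j by apply: contra_neq ji => ji; apply/val_inj.
  by rewrite linearZ/= ccoef_cvec ij scaler0.
rewrite big1// => j _; rewrite linearZ/= ccoef_cvec gtn_eqF ?scaler0//.
exact: leq_trans (ltn_ord j) nin.
Qed.

Lemma trunc_cvec n (j : nat) : (j < n)%N -> trunc n (cvec c j) = cvec c j.
Proof.
move=> jn; rewrite /trunc (bigD1 (Ordinal jn))//= ccoef_cvec eqxx scale1r.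
rewrite big1 ?addr0// => i ij; rewrite ccoef_cvec.
have /negbTE -> : i != j :> nat by apply: contra_neq ij => ij; apply/val_inj.
exact: scale0r.
Qed.

Lemma trunc_truncl m n x : (m <= n)%N -> trunc m (trunc n x) = trunc m x.
Proof.
move=> mn; rewrite [LHS]/trunc; apply: eq_bigr => i _.
by rewrite ccoef_trunc (leq_trans (ltn_ord i)).
Qed.

Lemma trunc_truncr m n x : (m <= n)%N -> trunc n (trunc m x) = trunc m x.
Proof.
move=> mn; rewrite [trunc m x]/trunc linear_sum; apply: eq_bigr => i _.
by rewrite linearZ/= trunc_cvec// (leq_trans (ltn_ord i)).
Qed.

Lemma trunc0_le m n x : (m <= n)%N -> trunc n x = 0 -> trunc m x = 0.
Proof. by move=> mn x0; rewrite -(trunc_truncl x mn) x0 linear0. Qed.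

Lemma trunc_id_le m n x : (m <= n)%N -> trunc m x = x -> trunc n x = x.
Proof. by move=> mn <-; rewrite trunc_truncr. Qed.

Lemma near_trunc x (e : R) : 0 < e ->
  \forall n \near \oo, normR (x - trunc n x) <= e.
Proof.
by move=> /(csum_cvg c x)[n0 xn0]; near=> n; apply: xn0; near: n; exists n0.
Unshelve. all: by end_near. Qed.

Lemma normR_sum (V : normedModType K) N (u : nat -> V) :
  normR (\sum_(i < N) u i) <= \sum_(i < N) normR (u i).
Proof.
elim/big_ind2 : _ => [|x a y b xa yb|//]; first by rewrite normR0.
by rewrite (le_trans (ler_normRD _ _))// lerD.
Qed.

Lemma normR_sum_const (V : normedModType K) N (u : nat -> V) (C : R) :
  (forall i, (i < N)%N -> normR (u i) <= C) ->
  normR (\sum_(i < N) u i) <= N%:R * C.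
Proof.
move=> uC; rewrite (le_trans (normR_sum _ _))//.
apply: (@le_trans _ _ (\sum_(i < N) C)); first by apply: ler_sum => i _; exact: uC.
by rewrite sumr_const card_ord mulr_natl.
Qed.

Lemma ler_normRB (V : normedModType K) (x y : V) :
  normR (x - y) <= normR x + normR y.
Proof. by rewrite (le_trans (ler_normRD _ _))// normRN. Qed.

Hypothesis p1 : 1 < p.
Let p0 : 0 < p. Proof. exact: lt_trans p1. Qed.

Lemma normR_trunc n x : normR (trunc n x) <= normR x.
Proof.
apply: (ler_of_powR p0); rewrite ?normR_ge0//.
by rewrite (powR_norm_split c n x) lerDl powR_ge0.
Qed.

Lemma normR_tail n x : normR (x - trunc n x) <= normR x.
Proof.
apply: (ler_of_powR p0); rewrite ?normR_ge0//.
by rewrite (powR_norm_split c n x) lerDr powR_ge0.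
Qed.

Definition block m n x := trunc n x - trunc m x.

Lemma normR_block m n x : (m <= n)%N -> normR (block m n x) <= normR x.
Proof.
move=> mn; rewrite /block -(trunc_truncl x mn).
by rewrite (le_trans (normR_tail _ _))// normR_trunc.
Qed.

Lemma trunc_block0 m n x : (m <= n)%N -> trunc m (block m n x) = 0.
Proof. by move=> mn; rewrite linearB/= trunc_truncl// trunc_truncl// subrr. Qed.

Lemma trunc_block m n x : (m <= n)%N -> trunc n (block m n x) = block m n x.
Proof. by move=> mn; rewrite linearB/= trunc_truncl// trunc_truncr. Qed.

(** * Disjoint blocks along an increasing sequence of levels *)

Section blocks.
Variable (n_ : nat -> nat).
Hypothesis n_incr : forall i, (n_ i <= n_ i.+1)%N.

Lemma levels_homo : {homo n_ : i j / (i <= j)%N}.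
Proof. by apply: homo_leq => // i j l; apply: leq_trans. Qed.

Lemma trunc_sum_blocks N (u : nat -> E) :
  (forall i, trunc (n_ i.+1) (u i) = u i) ->
  trunc (n_ N) (\sum_(i < N) u i) = \sum_(i < N) u i.
Proof.
move=> uhi; rewrite linear_sum; apply: eq_bigr => i _ /=.
by apply: trunc_id_le (uhi i); exact/levels_homo/ltn_ord.
Qed.

(** By induction on [N]: cutting at level [n_ N] separates the last block from the sum of the
    earlier ones. *)
Lemma powR_norm_sum_blocks N (u : nat -> E) :
  (forall i, trunc (n_ i) (u i) = 0) ->
  (forall i, trunc (n_ i.+1) (u i) = u i) ->
  normR (\sum_(i < N) u i) `^ p = \sum_(i < N) normR (u i) `^ p.
Proof.
move=> ulo uhi; elim: N => [|N IH].
  by rewrite !big_ord0 normR0 powR0// gt_eqF.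
have e : trunc (n_ N) (\sum_(i < N) u i + u N) = \sum_(i < N) u i.
  by rewrite linearD/= ulo addr0 trunc_sum_blocks.
rewrite !big_ord_recr/= -IH (powR_norm_split c (n_ N)) -/(trunc _ _) e.
by rewrite addrAC subrr add0r.
Qed.

Lemma sum_block N x :
  \sum_(i < N) block (n_ i) (n_ i.+1) x = block (n_ 0%N) (n_ N) x.
Proof.
elim: N => [|N IH]; first by rewrite big_ord0 /block subrr.
by rewrite big_ord_recr/= IH /block addrC subrKA.
Qed.

Lemma sum_powR_norm_block N x :
  \sum_(i < N) normR (block (n_ i) (n_ i.+1) x) `^ p <= normR x `^ p.
Proof.
rewrite -(@powR_norm_sum_blocks N (fun i => block (n_ i) (n_ i.+1) x)).
- rewrite sum_block ge0_ler_powR ?nnegrE ?normR_ge0 ?(ltW p0)//.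
  by rewrite normR_block// levels_homo.
- by move=> i; rewrite trunc_block0.
- by move=> i; rewrite trunc_block.
Qed.

Lemma normR_sum_blocks_le N (u : nat -> E) (C : R) :
  (forall i, trunc (n_ i) (u i) = 0) ->
  (forall i, trunc (n_ i.+1) (u i) = u i) ->
  (forall i, normR (u i) <= C) ->
  normR (\sum_(i < N) u i) <= C * N%:R `^ p^-1.
Proof.
move=> ulo uhi uC; have C0 : 0 <= C by rewrite (le_trans _ (uC 0%N)) ?normR_ge0.
apply: (ler_of_powR p0); rewrite ?normR_ge0 ?mulr_ge0 ?powR_ge0//.
rewrite powR_norm_sum_blocks// powRM ?powR_ge0// powRVK//.
rewrite (@le_trans _ _ (\sum_(i < N) C `^ p))//.
  by apply: ler_sum => i _; rewrite ge0_ler_powR ?nnegrE ?normR_ge0 ?(ltW p0).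
by rewrite sumr_const card_ord mulr_natr.
Qed.

(** Each [u i] is replaced by its exact block [v i], at distance at most 2e. The replacement changes
    the sum by at most 2eN, and lowering [d] to d - 2e costs at most 2eN more because N^(1/p) <=
    N. *)
Lemma normR_sum_almost_blocks_ge N (u : nat -> E) (d e : R) :
  (0 < N)%N -> 0 <= e ->
  (forall i, d <= normR (u i)) ->
  (forall i, normR (trunc (n_ i) (u i)) <= e) ->
  (forall i, normR (u i - trunc (n_ i.+1) (u i)) <= e) ->
  d * N%:R `^ p^-1 <= normR (\sum_(i < N) u i) + 4 * e * N%:R.
Proof.
move=> N0 e0 du ulo uhi; pose v i := block (n_ i) (n_ i.+1) (u i).
have N1 : 1 <= N%:R :> R by rewrite ler1n.
have NN : N%:R `^ p^-1 <= N%:R :> R.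
  by rewrite -[leRHS]powRr1// ler_powR// invf_le1// ltW.
have uv i : normR (u i - v i) <= 2 * e.
  have -> : u i - v i = (u i - trunc (n_ i.+1) (u i)) + trunc (n_ i) (u i).
    by rewrite /v /block opprB addrA addrAC.
  by rewrite (le_trans (ler_normRD _ _))// mulr2n mulrDl mul1r lerD.
have v0 i : d - 2 * e <= normR (v i).
  rewrite lerBlDl (le_trans (du i))// -[u i in leLHS](subrK (v i)).
  by rewrite (le_trans (ler_normRD _ _))// lerD.
have vu : normR (\sum_(i < N) v i) <= normR (\sum_(i < N) u i) + 2 * e * N%:R.
  have -> : \sum_(i < N) v i = \sum_(i < N) u i - \sum_(i < N) (u i - v i).
    by rewrite [X in _ - X]sumrB subKr.
  rewrite (le_trans (ler_normRB _ _))// lerD// mulrC.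
  exact: (@normR_sum_const _ _ (fun i => u i - v i)).
suff : (d - 2 * e) * N%:R `^ p^-1 <= normR (\sum_(i < N) v i).
  move=> h; rewrite -[d in leLHS](subrK (2 * e)) mulrDl.
  apply: le_trans (lerD (le_trans h vu) (ler_wpM2l _ NN)) _; last by lra.
  by rewrite mulr_ge0.
have [de|de] := leP (d - 2 * e) 0.
  by rewrite (@le_trans _ _ 0) ?normR_ge0// mulr_le0_ge0 ?powR_ge0.
apply: (ler_of_powR p0); rewrite ?normR_ge0 ?mulr_ge0 ?powR_ge0 ?(ltW de)//.
rewrite powR_norm_sum_blocks => [|i|i]; last 2 first.
  by rewrite trunc_block0.
  by rewrite trunc_block.
rewrite powRM ?powR_ge0 ?(ltW de)// powRVK//.
rewrite (@le_trans _ _ (\sum_(i < N) (d - 2 * e) `^ p))//.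
  by rewrite sumr_const card_ord mulr_natr.
apply: ler_sum => i _.
by rewrite ge0_ler_powR ?nnegrE ?normR_ge0 ?(ltW p0) ?(ltW de).
Qed.

End blocks.
End coord_system.

(** * Gliding humps *)

Section scalars.
Context {R : realType} {k : kind}.
Local Notation K := (sfield R k).

Lemma normR1 : normR (1 : K^o) = 1.
Proof. by rewrite /normR normr1 -(@ofreal1 _ k) ofrealK. Qed.

Lemma toreal_norm_gt0 (a : K) : a != 0 -> 0 < toreal `|a|.
Proof.
by move=> a0; rewrite -(@ltr_ofreal _ k) torealK// ofreal0 normr_gt0.
Qed.

Lemma toreal_normV (a : K) : toreal `|a^-1| = (toreal `|a|)^-1.
Proof.
have [->|a0] := eqVneq a 0.
  by rewrite invr0 normr0 -(@ofreal0 _ k) ofrealK invr0.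
apply: (mulIf (lt0r_neq0 (toreal_norm_gt0 a0))).
rewrite mulVf ?lt0r_neq0 ?toreal_norm_gt0//.
have := @normRZ R k K^o a^-1 a.
by rewrite /normR => <-; rewrite [a^-1 *: a]mulVf// -[RHS]normR1.
Qed.

Lemma normR_gt0 (V : normedModType K) (x : V) : x != 0 -> 0 < normR x.
Proof.
move=> x0; rewrite lt_neqAle normR_ge0 andbT eq_sym.
by apply: contra_neq x0 => /normR0_eq0.
Qed.

Lemma normRZV (V : normedModType K) (a : K) (x : V) :
  normR (a^-1 *: x) = normR x / toreal `|a|.
Proof. by rewrite normRZ toreal_normV mulrC. Qed.

Lemma toreal_norm_id (V : normedModType K) (x : V) : toreal `| `|x| | = normR x.
Proof. by rewrite normr_id. Qed.

Lemma normR_nat (n : nat) : normR (n%:R : K^o) = n%:R.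
Proof.
rewrite /normR normr_nat; have -> : n%:R = ofreal n%:R :> K.
  by elim: n => [|n IH]; rewrite ?ofreal0// !mulrSr ofrealD ofreal1 IH.
exact: ofrealK.
Qed.

End scalars.

(** Dependent choice for gliding humps: the upper level reached by one object is the lower level of
    the next. *)
Lemma level_chain (T : Type) (Good : nat -> T -> nat -> Prop) :
  (forall m, exists o m', (m <= m')%N /\ Good m o m') ->
  forall m0, exists (o : nat -> T) (n : nat -> nat),
    [/\ n 0%N = m0, forall i, (n i <= n i.+1)%N &
        forall i, Good (n i) (o i) (n i.+1)].
Proof.
move=> H m0.
have /choice[g gP] : forall m, exists om : T * nat,
    (m <= om.2)%N /\ Good m om.1 om.2.
  by move=> m; case: (H m) => o [m' om]; exists (o, m').
pose n i := iter i (fun m => (g m).2) m0.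
by exists (fun i => (g (n i)).1), n; split => // i; case: (gP (n i)).
Qed.

(** * Weak nullity of tails, and its consequences for bounded operators *)

Section weakly_null.
Context {R : realType} {k : kind}.
Local Notation K := (sfield R k).
Context {E : normedModType K} {p : R} (c : coord_system p E) (p1 : 1 < p).

(** Truncations converge and [L] is continuous, so a strict inequality survives truncation. This
    gives the humps finite support. *)
Lemma near_ltr_norm_trunc (H : normedModType K) (L : {linear E -> H}) (M a : R)
    (z : E) : (forall x, normR (L x) <= M * normR x) -> a < normR (L z) ->
  \forall n \near \oo, a < normR (L (trunc c n z)).
Proof.
move=> LM az; have M0 : 0 < `|M| + 1 by rewrite ltr_wpDl.
(* A vector this small is moved by [L] over at most half the gap between [a] and the norm of
   [L z]. *)
have e0 : 0 < (normR (L z) - a) / 2 / (`|M| + 1).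
  by rewrite !divr_gt0// subr_gt0.
near=> n; have : normR (z - trunc c n z) <= (normR (L z) - a) / 2 / (`|M| + 1).
  by near: n; exact: near_trunc.
rewrite ler_pdivlMr// => zn.
have : normR (L (z - trunc c n z)) <= (normR (L z) - a) / 2.
  rewrite (le_trans (LM _))// (le_trans _ zn)// mulrC ler_wpM2l ?normR_ge0//.
  by rewrite (le_trans (ler_norm _))// lerDl.
have : normR (L z) <= normR (L (z - trunc c n z)) + normR (L (trunc c n z)).
  by rewrite (le_trans _ (ler_normRD _ _))// -linearD subrK.
move: az; set u := normR _; set v := normR _; set w := normR _; lra.
Unshelve. all: by end_near. Qed.

(** A tail estimate at level [m] passes to every later level, by applying it to the tail itself;
    hence one good level suffices in the two tail estimates below. *)
Lemma tail_tail m n (x : E) : (m <= n)%N ->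
  x - trunc c n x = (x - trunc c n x) - trunc c m (x - trunc c n x).
Proof. by move=> mn; rewrite linearB/= trunc_truncl// subrr subr0. Qed.

(* If [g] were large on vectors with arbitrarily late support, it would be [N]
   on a sum of [N] disjoint blocks, whose norm is only of order [N `^ p^-1]. *)
Lemma near_functional_tail (g : {linear E -> K^o}) (M e : R) :
  (forall x, normR (g x) <= M * normR x) -> 0 < e ->
  \forall m \near \oo, forall x, normR (g (x - trunc c m x)) <= e * normR x.
Proof.
move=> gM e0; suff [m0 m0P] : exists m, forall x,
    normR (g (x - trunc c m x)) <= e * normR x.
  exists m0 => // m /= m0m x; rewrite (tail_tail _ m0m).
  by rewrite (le_trans (m0P _))// ler_pM2l// normR_tail.
apply: contrapT => /forallNP H.
have : forall m, exists y n, (m <= n)%N /\ [/\ trunc c m y = 0,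
    trunc c n y = y, g y = 1 & normR y <= e^-1].
  move=> m; have /existsNP[x /negP] := H m; rewrite -ltNge => xm.
  set z := x - trunc c m x in xm.
  have [n [mn gn]] : exists n, (m <= n)%N /\ e * normR x < normR (g (trunc c n z)).
    apply: (@filter_ex _ \oo); near=> n; split; first by near: n; exact: nbhs_infty_ge.
    by near: n; exact: near_ltr_norm_trunc gM xm.
  set y := trunc c n z in gn.
  have y0 : trunc c m y = 0 by rewrite trunc_truncl// linearB/= trunc_truncl// subrr.
  have gy : g y != 0.
    apply: contraTneq gn => ->.
    by rewrite normR0 -leNgt mulr_ge0 ?normR_ge0// ltW.
  exists ((g y)^-1 *: y), n; split=> //; split.
  - by rewrite linearZ/= y0 scaler0.
  - by rewrite linearZ/= trunc_truncl.
  - by rewrite linearZ/=; exact: mulVf.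
  - rewrite normRZV ler_pdivrMr ?toreal_norm_gt0// ler_pdivlMl//.
    rewrite (le_trans _ (ltW gn))// ler_pM2l//.
    by rewrite (le_trans (normR_trunc _ p1 _ _))// normR_tail.
move=> /level_chain/(_ 0%N)[y [n [_ nS yP]]].
apply: (@ltr_powR_growth R 1 (`|M| / e) 1 p^-1) => //.
  by rewrite invf_lt1// (lt_trans _ p1).
move=> N N0; rewrite mul1r powRr1//.
have gN : g (\sum_(i < N) y i) = N%:R.
  rewrite linear_sum/= (eq_bigr (fun=> 1)).
    by rewrite sumr_const card_ord.
  by move=> i _; have [] := yP i.
rewrite -[leLHS](@normR_nat R k) -gN (le_trans (gM _))//.
apply: (@le_trans _ _ (`|M| * normR (\sum_(i < N) y i))).
  by rewrite ler_wpM2r ?normR_ge0 ?ler_norm.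
rewrite -mulrA ler_wpM2l//.
by apply: (normR_sum_blocks_le (c := c) p1 nS) => i; have [] := yP i.
Unshelve. all: by end_near. Qed.

Context {F : normedModType K} {q : R} (d : coord_system q F).

Lemma normR_trunc_coef n (y : F) (a : R) :
  (forall i, (i < n)%N -> normR (ccoef d i y) <= a) ->
  normR (trunc d n y) <= n%:R * a.
Proof.
move=> ya; apply: (@normR_sum_const _ _ _ _ (fun i => ccoef d i y *: cvec d i)).
move=> i /ya ia; rewrite normRZ (le_trans _ ia)// ler_piMr ?toreal_norm_ge0//.
exact: normR_cvec.
Qed.

(** The first [n] coordinates of [S] are finitely many bounded functionals, each uniformly small on
    late tails by [near_functional_tail]. *)
Lemma near_trunc_tail (S : bop E F) n (e : R) : 0 < e ->
  \forall m \near \oo, forall x,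
    normR (trunc d n (S (x - trunc c m x))) <= e * normR x.
Proof.
move=> e0; have [M M0 SM] := bop_bounded S.
have n0 : 0 < n%:R + 1 :> R by rewrite ltr_wpDl.
have : \forall m \near \oo, forall i : 'I_n, forall x,
    normR (ccoef d i (S (x - trunc c m x))) <= e / (n%:R + 1) * normR x.
  apply: filter_forall => i.
  apply: (@near_functional_tail (ccoef d i \o S) M); last by rewrite divr_gt0.
  by move=> x; exact: le_trans (normR_ccoef _ _ _) (SM x).
apply: filterS => m H x.
rewrite (le_trans (normR_trunc_coef (fun i ni => H (Ordinal ni) x)))//.
rewrite mulrA ler_wpM2r ?normR_ge0// mulrA ler_pdivrMr// mulrC ler_pM2l//.
by rewrite lerDl.
Qed.

(** The range of [S] after truncation is spanned by the [n] vectors [S (cvec c i)], so it suffices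
    to approximate these by their truncations. *)
Lemma near_tail_trunc (S : bop E F) n (e : R) : 0 < e ->
  \forall m \near \oo, forall x,
    normR (S (trunc c n x) - trunc d m (S (trunc c n x))) <= e * normR x.
Proof.
move=> e0; have n0 : 0 < n%:R + 1 :> R by rewrite ltr_wpDl.
have : \forall m \near \oo, forall i : 'I_n,
    normR (S (cvec c i) - trunc d m (S (cvec c i))) <= e / (n%:R + 1).
  by apply: filter_forall => i; apply: near_trunc; rewrite divr_gt0.
apply: filterS => m H x.
have -> : S (trunc c n x) - trunc d m (S (trunc c n x)) =
    \sum_(i < n) ccoef c i x *: (S (cvec c i) - trunc d m (S (cvec c i))).
  have -> : S (trunc c n x) = \sum_(i < n) ccoef c i x *: S (cvec c i).
    by rewrite linear_sum; apply: eq_bigr => i _; rewrite linearZ.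
  rewrite (linear_sum (trunc d m)) /= -sumrB.
  by apply: eq_bigr => i _; rewrite linearZ/= scalerBr.
apply: (@le_trans _ _ (n%:R * (e / (n%:R + 1) * normR x))).
  apply: (@normR_sum_const _ _ _ _
    (fun i => ccoef c i x *: (S (cvec c i) - trunc d m (S (cvec c i))))).
  move=> i ni; rewrite normRZ mulrC ler_pM ?normR_ge0 ?toreal_norm_ge0//.
    exact: H (Ordinal ni).
  exact: normR_ccoef.
rewrite mulrA ler_wpM2r ?normR_ge0// mulrA ler_pdivrMr// mulrC ler_pM2l//.
by rewrite lerDl.
Qed.

End weakly_null.

(** * Pitt's theorem *)

Section pitt.
Context {R : realType} {k : kind}.
Local Notation K := (sfield R k).

(** Convergence in operator norm of the finite corners of [S] to [S]; this is the form in which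
    compactness is used. *)
Definition trunc_approx {E F : normedModType K} {p q : R}
    (c : coord_system p E) (d : coord_system q F) (S : bop E F) :=
  forall e : R, 0 < e -> \forall n \near \oo, forall x,
    normR (S x - trunc d n (S (trunc c n x))) <= e * normR x.

Context {E F : normedModType K} {p q : R}.
Context (c : coord_system p E) (d : coord_system q F).
Hypotheses (p1 : 1 < p) (pq : p < q).
Let q1 : 1 < q. Proof. exact: lt_trans pq. Qed.

(* Otherwise [S] is bounded below on a sequence of disjoint blocks whose images
   are almost disjoint, and [N `^ p^-1] is dominated by [N `^ q^-1]. *)
Lemma near_bop_tail (S : bop F E) (e : R) : 0 < e ->
  \forall m \near \oo, forall x, normR (S (x - trunc d m x)) <= e * normR x.
Proof.
move=> e0; suff [m0 m0P] : exists m, forall x,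
    normR (S (x - trunc d m x)) <= e * normR x.
  exists m0 => // m /= m0m x; rewrite (tail_tail d _ m0m).
  by rewrite (le_trans (m0P _))// ler_pM2l// normR_tail.
apply: contrapT => /forallNP H.
have [M M0 SM] := bop_bounded S.
(* Summing [N] humps will give e N^(1/p) <= M N^(1/q) + 1, and N^(1/q) >= 1 absorbs the last
   term. *)
apply: (@ltr_powR_growth R e (M + 1) p^-1 q^-1) => //.
  by rewrite ltf_pV2// posrE (lt_trans ltr01)// ltW.
(* With this [eta] the error 4 eta N of [normR_sum_almost_blocks_ge] equals 1. *)
move=> N N0; pose eta := (4 * N%:R : R)^-1.
have N0R : 0 < N%:R :> R by rewrite ltr0n.
have eta0 : 0 < eta by rewrite invr_gt0 mulr_gt0.
have : forall m, exists y n, (m <= n)%N /\ [/\ trunc d m y = 0,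
    trunc d n y = y /\ normR y <= 1, e <= normR (S y),
    normR (trunc c m (S y)) <= eta & normR (S y - trunc c n (S y)) <= eta].
  move=> m.
  (* Beyond [m1], the images under [S] hardly meet the first [m] coordinates; this makes successive
     images almost disjoint. *)
  have [m1 [mm1 m1P]] : exists m1, (m <= m1)%N /\ forall x,
      normR (trunc c m (S (x - trunc d m1 x))) <= eta * normR x.
    apply: (@filter_ex _ \oo); near=> n; split; first by near: n; exact: nbhs_infty_ge.
    by near: n; exact: near_trunc_tail.
  have /existsNP[x /negP] := H m1; rewrite -ltNge => xm.
  set z := x - trunc d m1 x in xm.
  have [n1 [mn1 Sn1]] : exists n, (m1 <= n)%N /\ e * normR x < normR (S (trunc d n z)).
    apply: (@filter_ex _ \oo); near=> n; split; first by near: n; exact: nbhs_infty_ge.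
    by near: n; exact: near_ltr_norm_trunc SM xm.
  have x0 : x != 0.
    apply: contraTneq xm => x0.
    have -> : z = 0 by rewrite /z x0 linear0 subr0.
    by rewrite -leNgt linear0 normR0 mulr_ge0 ?normR_ge0 ?ltW.
  set w := trunc d n1 z in Sn1.
  have w0 : trunc d m1 w = 0 by rewrite trunc_truncl// linearB/= trunc_truncl// subrr.
  have wx : normR w <= normR x.
    by rewrite (le_trans (normR_trunc _ q1 _ _))// normR_tail.
  pose y := `|x|^-1 *: w.
  have [n [n1n Sn]] : exists n, (n1 <= n)%N /\ normR (S y - trunc c n (S y)) <= eta.
    apply: (@filter_ex _ \oo); near=> n; split; first by near: n; exact: nbhs_infty_ge.
    by near: n; exact: near_trunc.
  have nx0 := normR_gt0 x0.
  exists y, n; split; first exact: leq_trans (leq_trans mm1 mn1) n1n.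
  split=> //.
  - by rewrite linearZ/= (trunc0_le mm1 w0) scaler0.
  - split; first by rewrite linearZ/= trunc_truncr.
    by rewrite normRZV toreal_norm_id ler_pdivrMr// mul1r.
  - by rewrite linearZ/= normRZV toreal_norm_id ler_pdivlMr// ltW.
  - rewrite !linearZ/= normRZV toreal_norm_id ler_pdivrMr//.
    rewrite -[w in leLHS]subr0 -w0 (le_trans (m1P _))//.
    by rewrite ler_pM2l.
move=> /level_chain/(_ 0%N)[y [n [_ nS yP]]].
have := normR_sum_almost_blocks_ge (c := c) p1 nS (u := S \o y) N0 (ltW eta0).
move=> /(_ e) Hge; apply: (le_trans (Hge _ _ _)) => [i|i|i|] /=.
- by have [] := yP i.
- by have [] := yP i.
- by have [] := yP i.
have -> : 4 * eta * N%:R = 1.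
  by rewrite /eta invfM mulrA divff// mul1r mulVf// gt_eqF.
rewrite mulrDl mul1r lerD//; last first.
  by rewrite -[leLHS](powRr0 N%:R) ler_powR ?ler1n// invr_ge0 ltW// (lt_trans ltr01).
rewrite -linear_sum (le_trans (SM _))// ler_wpM2l// -[leRHS]mul1r.
by apply: (normR_sum_blocks_le (c := d) q1 nS) => i; have [? []] := yP i.
Unshelve. all: by end_near. Qed.

(** Fix [m] such that [S] is small on tails beyond [m]. The error at level [n] consists of [S] on
    the tail beyond [n], the tail of the finite-rank operator S P_m, and the tail of [S] on the
    coordinates between [m] and [n]; each is at most a third of the tolerance. *)
Lemma pitt (S : bop F E) : trunc_approx d c S.
Proof.
move=> e e0; have e3 : 0 < e / 3 by rewrite divr_gt0.
have [m mP] : exists m, forall x, normR (S (x - trunc d m x)) <= e / 3 * normR x.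
  by apply: (@filter_ex _ \oo); exact: near_bop_tail.
near=> n => x.
have mn : (m <= n)%N by near: n; exact: nbhs_infty_ge.
have h1 : normR (S (x - trunc d n x)) <= e / 3 * normR x.
  by move: x; near: n; exact: near_bop_tail.
have h2 : normR (S (trunc d m x) - trunc c n (S (trunc d m x))) <= e / 3 * normR x.
  by move: x {h1}; near: n; exact: near_tail_trunc.
pose y := trunc d n x; pose z := S (y - trunc d m y).
have h3 : normR (z - trunc c n z) <= e / 3 * normR x.
  rewrite (le_trans (normR_tail _ _ _ _))// (le_trans (mP _))// ler_pM2l//.
  by rewrite normR_trunc.
have -> : S x - trunc c n (S y) = S (x - y) +
    ((S (trunc d m x) - trunc c n (S (trunc d m x))) + (z - trunc c n z)).
  rewrite /z -[trunc d m x](trunc_truncl d x mn) -/y !linearB/=.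
  set a := S y; set b := S (trunc d m y).
  set a' := trunc c n a; set b' := trunc c n b.
  rewrite opprK (addrACA a) [- b + b']addrC -(opprB b b') [b - b' + _]addrC subrK.
  by rewrite subrKA.
rewrite (le_trans (ler_normRD _ _))//.
rewrite (le_trans (lerD h1 (le_trans (ler_normRD _ _) (lerD h2 h3))))//.
by lra.
Unshelve. all: by end_near. Qed.

End pitt.

(** * Upper and lower estimates for sums of L-shaped operators *)

Section estimates.
Context {R : realType} {k : kind}.
Local Notation K := (sfield R k).
Context {E F : normedModType K} {p q : R}.
Context (c : coord_system p E) (d : coord_system q F).
Hypotheses (p1 : 1 < p) (pq : p < q).
Let p0 : 0 < p. Proof. exact: lt_trans p1. Qed.
Let q1 : 1 < q. Proof. exact: lt_trans pq. Qed.

(** A bound of at least 1 can be divided by, and inserted as a factor into any estimate. *)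
Lemma bop_bounded1 {E1 F1 : normedModType K} (S : bop E1 F1) :
  exists2 M : R, 1 <= M & forall x, normR (S x) <= M * normR x.
Proof.
have [M M0 SM] := bop_bounded S; exists (M + 1); first by rewrite lerDr.
by move=> x; rewrite (le_trans (SM x))// ler_wpM2r ?normR_ge0// lerDl.
Qed.

(** Pitt's theorem concerns maps from ell_q to ell_p, while this composite goes the other way; it
    inherits compactness from [S]. Once [S] is replaced by a fixed corner, [near_tail_trunc] and
    [near_trunc_tail] truncate on both sides. *)
Lemma trunc_approx_sandwich (A B : bop E F) (S : bop F E) :
  trunc_approx c d (bcomp A (bcomp S B)).
Proof.
move=> e e0.
have [a a1 Aa] := bop_bounded1 A.
have [b b1 Bb] := bop_bounded1 B.
have [s s1 Ss] := bop_bounded1 S.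
have a0 : 0 < a by rewrite (lt_le_trans _ a1).
have b0 : 0 < b by rewrite (lt_le_trans _ b1).
have s0 : 0 < s by rewrite (lt_le_trans _ s1).
(* The 4 counts the error terms [h1] to [h4], each at most a b s dl times the norm of [x]. *)
have C0 : 0 < a * b * s * 4 by rewrite !mulr_gt0.
have dl0 : 0 < e / (a * b * s * 4) by rewrite divr_gt0.
set dl := e / _ in dl0.
have [m mP] : exists m, forall x,
    normR (S x - trunc c m (S (trunc d m x))) <= dl * normR x.
  by apply: (@filter_ex _ \oo); exact: pitt.
near=> n => x.
pose D y := S y - trunc c m (S (trunc d m y)).
pose U y := A (trunc c m (S (trunc d m (B y)))).
have TE y : bcomp A (bcomp S B) y = A (D (B y)) + U y.
  by rewrite /U -linearD /D subrK.
have hD y : normR (A (D (B y))) <= a * (dl * (b * normR y)).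
  rewrite (le_trans (Aa _))// ler_pM2l// (le_trans (mP _))// ler_pM2l//.
have h1 : normR (A (D (B x))) <= a * (dl * (b * normR x)) by exact: hD.
have h2 : normR (trunc d n (A (D (B (trunc c n x))))) <= a * (dl * (b * normR x)).
  rewrite (le_trans (normR_trunc _ _ _ _))// (le_trans (hD _))//.
  by rewrite !ler_pM2l// normR_trunc.
have h3 : normR (U x - trunc d n (U x)) <= dl * (s * (b * normR x)).
  have : forall u, normR (A (trunc c m u) - trunc d n (A (trunc c m u))) <= dl * normR u.
    by near: n; exact: near_tail_trunc.
  move/(_ (S (trunc d m (B x)))) => h; rewrite (le_trans h)// ler_pM2l//.
  rewrite (le_trans (Ss _))// ler_pM2l// (le_trans _ (Bb _))//.
  by rewrite normR_trunc.
have h4 : normR (trunc d n (U (x - trunc c n x))) <= a * (s * (dl * normR x)).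
  rewrite (le_trans (normR_trunc _ _ _ _))// (le_trans (Aa _))// ler_pM2l//.
  rewrite (le_trans (normR_trunc _ _ _ _))// (le_trans (Ss _))// ler_pM2l//.
  by move: x {h1 h2 h3}; near: n; exact: near_trunc_tail.
have -> : bcomp A (bcomp S B) x - trunc d n (bcomp A (bcomp S B) (trunc c n x)) =
    (A (D (B x)) - trunc d n (A (D (B (trunc c n x))))) +
    ((U x - trunc d n (U x)) + trunc d n (U (x - trunc c n x))).
  have -> : U (x - trunc c n x) = U x - U (trunc c n x) by rewrite /U !linearB.
  rewrite !TE (linearD (trunc d n)) (linearB (trunc d n)) /=.
  by rewrite subrKA opprD addrACA.
have -> : e = dl * (a * b * s * 4) by rewrite /dl divfK// gt_eqF.
have x0 := normR_ge0 x.
have ab : a * b * dl * normR x <= a * b * s * dl * normR x.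
  by rewrite !ler_wpM2r// ?(ltW dl0)// ler_peMr// mulr_ge0// ltW.
have sb : s * b * dl * normR x <= a * b * s * dl * normR x.
  by rewrite !ler_wpM2r// ?(ltW dl0)// mulrC -mulrA ler_peMl// mulr_ge0// ltW.
have as_ : a * s * dl * normR x <= a * b * s * dl * normR x.
  by rewrite !ler_wpM2r// ?(ltW dl0)// ?(ltW s0)// ler_peMr// ltW.
rewrite (le_trans (ler_normRD _ _))//.
rewrite (le_trans (lerD (le_trans (ler_normRB _ _) (lerD h1 h2))
  (le_trans (ler_normRD _ _) (lerD h3 h4))))//.
by lra.
Unshelve. all: by end_near. Qed.

(** * Sums of L-shaped operators along a fixed sequence of levels *)

Section levels.
Variable n : nat -> nat.
Hypothesis n_incr : forall i, (n i <= n i.+1)%N.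

(* [T i] is split into a diagonal block, the rows to its left and the columns
   above it; the three sums are of order [1], [N `^ q^-1] and
   [N `^ (1 - p^-1)]. *)
Lemma normR_sum_corners (T : nat -> bop E F) (C e r g : R) (N : nat) (x : E) :
  (0 < N)%N -> 0 <= C -> 0 <= e -> 0 <= r -> 0 <= g ->
  (forall i y, normR (T i y) <= C * normR y) ->
  (forall i y, trunc d (n i) (T i (trunc c (n i) y)) = 0) ->
  (forall i y, normR (T i y - trunc d (n i.+1) (T i (trunc c (n i.+1) y))) <=
     e * normR y) ->
  (forall i y, normR (T i (trunc c (n i) y)) <= r * normR y) ->
  (forall i y, normR (trunc d (n i) (T i y)) <= g * normR y) ->
  normR (\sum_(i < N) T i x) <=
    (C + e * N%:R + r * N%:R `^ q^-1 + 2 * g * N%:R `^ (1 - p^-1)) * normR x.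
Proof.
move=> N0 C0 e0 r0 g0 TC Tlo Thi Tr Tg.
pose Q i := block c (n i) (n i.+1) x.
pose a i := block d (n i) (n i.+1) (T i (Q i)).
pose b i := block d (n i) (n i.+1) (T i (trunc c (n i) x)).
pose h i := trunc d (n i) (T i (Q i)).
pose u i := T i x - trunc d (n i.+1) (T i (trunc c (n i.+1) x)).
have TE i : T i x = u i + (a i + b i + h i).
  rewrite -[LHS](subrK (trunc d (n i.+1) (T i (trunc c (n i.+1) x)))) -/(u i).
  congr (_ + _); rewrite -[trunc c (n i.+1) x](subrK (trunc c (n i) x)) -/(Q i).
  rewrite linearD linearD/= addrAC /a /b /h /block subrK Tlo subr0.
  by [].
have qn0 := lt_trans ltr01 q1.
have nx0 := normR_ge0 x.
have ha : normR (\sum_(i < N) a i) <= C * normR x.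
  apply: (ler_of_powR qn0); rewrite ?normR_ge0 ?mulr_ge0//.
  rewrite (powR_norm_sum_blocks (c := d) q1 n_incr) => [|i|i]; last 2 first.
    by rewrite trunc_block0.
    by rewrite trunc_block.
  apply: (@le_trans _ _ (\sum_(i < N) (C * normR (Q i)) `^ q)).
    apply: ler_sum => i _.
    rewrite ge0_ler_powR ?nnegrE ?(ltW qn0) ?mulr_ge0 ?normR_ge0//.
    by rewrite (le_trans (normR_block _ q1 _ _))// n_incr.
  (* The blocks of [x] are p-summable and the diagonal images are measured in ell_q; as p <= q, no
     power of [N] is lost. *)
  apply: (@sum_powR_le_of_le _ p q _ _ (fun i => C * normR (Q i))) => //.
  - exact: ltW.
  - by rewrite mulr_ge0.
  - by move=> i; rewrite mulr_ge0// normR_ge0.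
  rewrite powRM// (eq_bigr (fun i : 'I_N => C `^ p * normR (Q i) `^ p)).
    by rewrite -mulr_sumr ler_wpM2l ?powR_ge0// sum_powR_norm_block.
  by move=> i _; rewrite powRM// normR_ge0.
have hb : normR (\sum_(i < N) b i) <= r * normR x * N%:R `^ q^-1.
  apply: (normR_sum_blocks_le (c := d) q1 n_incr) => i.
  - by rewrite trunc_block0.
  - by rewrite trunc_block.
  by rewrite (le_trans (normR_block _ q1 _ _))// n_incr.
(* The [h i] may overlap, so only the triangle inequality is available; Hoelder's inequality on the
   blocks of [x] gives the exponent 1 - 1/p. *)
have hh : normR (\sum_(i < N) h i) <= g * (2 * normR x * N%:R `^ (1 - p^-1)).
  rewrite (le_trans (normR_sum _ _))//.
  apply: (@le_trans _ _ (\sum_(i < N) g * normR (Q i))).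
    by apply: ler_sum => i _; exact: Tg.
  rewrite -mulr_sumr ler_wpM2l//.
  apply: (@sum_le_of_sum_powR _ p _ _ (fun i => normR (Q i))) => //.
    by move=> i; exact: normR_ge0.
  exact: sum_powR_norm_block.
have hu : normR (\sum_(i < N) u i) <= N%:R * (e * normR x).
  by apply: normR_sum_const => i _; exact: Thi.
have -> : \sum_(i < N) T i x = \sum_(i < N) u i +
    (\sum_(i < N) a i + \sum_(i < N) b i + \sum_(i < N) h i).
  by rewrite -!big_split/=; apply: eq_bigr => i _; exact: TE.
rewrite (le_trans (ler_normRD _ _))//.
rewrite (le_trans (lerD hu (le_trans (ler_normRD _ _)
  (lerD (le_trans (ler_normRD _ _) (lerD ha hb)) hh))))//.
by lra.
Qed.

(** In the double sum of all S_i x_j only the diagonal matters: the off-diagonal terms contribute at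
    most N^2 e. *)
Lemma normR_sum_diag (H : normedModType K) (h : nat -> nat -> H) (e : R) N :
  (forall i j, i != j -> normR (h i j) <= e) -> 0 <= e ->
  normR (\sum_(i < N) h i i) <=
    normR (\sum_(i < N) \sum_(j < N) h i j) + N%:R * (N%:R * e).
Proof.
move=> he e0; rewrite -lerBlDl.
pose g i j := if i == j then 0 else h i j.
have -> : \sum_(i < N) h i i =
    \sum_(i < N) \sum_(j < N) h i j - \sum_(i < N) \sum_(j < N) g i j.
  rewrite -sumrB; apply: eq_bigr => i _; rewrite -sumrB (bigD1 i)//= /g eqxx subr0.
  rewrite big1 ?addr0// => j ji; have /negbTE -> : i != j :> nat.
    by apply: contra_neq ji => ji; apply/val_inj.
  by rewrite subrr.
rewrite lerBlDl (le_trans (ler_normRB _ _))// lerD//.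
apply: (@normR_sum_const _ _ _ _ (fun i => \sum_(j < N) g i j)) => i _.
apply: (@normR_sum_const _ _ _ _ (g i)) => j _.
by rewrite /g; case: eqVneq => [_|/he//]; rewrite normR0.
Qed.

Variable S : nat -> bop F E.
Variable e : R.
Hypothesis e0 : 0 <= e.
Hypothesis Slo : forall i y, trunc c (n i) (S i (trunc d (n i) y)) = 0.
Hypothesis Shi : forall i y,
  normR (S i y - trunc c (n i.+1) (S i (trunc d (n i.+1) y))) <= e * normR y.

Lemma normR_late i y : trunc d (n i.+1) y = 0 -> normR (S i y) <= e * normR y.
Proof.
move=> y0; rewrite -[S i y]subr0 -(@linear0 _ _ _ _ (trunc c (n i.+1))).
by rewrite -(linear0 (S i)) -y0.
Qed.

Lemma sum_bop_apply N (y : F) : (\sum_(i < N) S i) y = \sum_(i < N) S i y.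
Proof.
elim: N => [|N IH]; first by rewrite !big_ord0.
by rewrite !big_ord_recr/= -IH.
Qed.

(** The sum is tested on the single unit vector [cvec d j]. As [j] lies below all levels, [Slo] and
    [Shi] make the columns [S i (cvec d j)] almost disjoint blocks in ell_p. *)
Lemma lower_column N (j : nat) (dl : R) : (0 < N)%N -> (j < n 0)%N ->
  (forall i, dl <= normR (S i (cvec d j))) ->
  dl * N%:R `^ p^-1 <= normR (\sum_(i < N) S i) + 4 * e * N%:R.
Proof.
move=> N0 jn Sdl.
have jni i : (j < n i)%N by rewrite (leq_trans jn)// levels_homo.
have := @normR_sum_almost_blocks_ge _ _ _ _ c p1 n n_incr N
  (fun i => S i (cvec d j)) dl e N0 e0 Sdl.
move=> /(_ _ _) h; apply: le_trans (h _ _) _ => [i|i|].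
- by rewrite -(trunc_cvec d (jni i)) Slo normR0.
- have := Shi i (cvec d j); rewrite trunc_cvec// => /le_trans; apply.
  by rewrite ler_piMr// normR_cvec.
rewrite lerD2r -sum_bop_apply (le_trans (ler_opnormR _ _))// -normR_bopE.
by rewrite ler_piMr ?normR_ge0// normR_cvec.
Qed.

(** Passing from [x] to its middle block drops the late part, on which [S i] is small, and the early
    part, which is kept explicitly. *)
Lemma normR_split i x : normR (S i (block d (n i) (n i.+1) x) -
  (S i x - S i (trunc d (n i) x))) <= e * normR x.
Proof.
have -> : S i (block d (n i) (n i.+1) x) - (S i x - S i (trunc d (n i) x)) =
    - S i (x - trunc d (n i.+1) x).
  by rewrite /block !(linearB (S i))/= !opprB subrKA.
rewrite normRN (le_trans (normR_late _))//.
  by rewrite linearB/= trunc_truncl// subrr.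
by rewrite ler_wpM2l// normR_tail.
Qed.

(** This and the next lemma control the cross terms S_i x_j: for i < j, x_j lies where [normR_late]
    applies; for j < i, it lies below level [n i]. *)
Lemma block_late i j x : (i < j)%N ->
  trunc d (n i.+1) (block d (n j) (n j.+1) x) = 0.
Proof.
move=> ij; apply: (@trunc0_le _ _ _ _ d _ (n j)); first exact: levels_homo.
by rewrite trunc_block0.
Qed.

Lemma block_early i j x : (j < i)%N ->
  block d (n j) (n j.+1) x = trunc d (n i) (block d (n j) (n j.+1) x).
Proof.
move=> ji; rewrite (@trunc_id_le _ _ _ _ d (n j.+1))//; first exact: levels_homo.
by rewrite trunc_block.
Qed.

(** Dual to [lower_column]: blocks x_i of norm at most 2 / dl are chosen with j-th coordinate of S_i
    x_i equal to 1. On their sum, of norm at most (2 / dl) N^(1/q), row [j] of the sum of the S_i is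
    close to [N], whence the exponent 1 - 1/q. *)
Lemma lower_row N (j : nat) (dl : R) : (0 < N)%N -> (j < n 0)%N -> 0 < dl ->
  e <= dl / 2 -> e * N%:R ^+ 2 <= 1 ->
  (forall i, exists x, dl * normR x < normR (ccoef c j (S i x))) ->
  dl / 2 * N%:R `^ (1 - q^-1) <= normR (\sum_(i < N) S i) + 1.
Proof.
move=> N0 jn dl0 edl eN Sdl.
have jni i : (j < n i)%N by rewrite (leq_trans jn)// levels_homo.
have f0 i y : ccoef c j (S i (trunc d (n i) y)) = 0.
  have := ccoef_trunc c (n i) (S i (trunc d (n i) y)) j.
  by rewrite jni Slo linear0.
have : forall i, exists x, [/\ trunc d (n i) x = 0, trunc d (n i.+1) x = x,
    ccoef c j (S i x) = 1 & normR x <= 2 / dl].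
  move=> i; have [x xdl] := Sdl i.
  pose y := block d (n i) (n i.+1) x.
  (* The early part of [x] contributes nothing to row [j] by [f0], and the late part costs at most e
     <= dl / 2. *)
  have y1 : dl / 2 * normR x < normR (ccoef c j (S i y)).
    have := le_trans (normR_ccoef c j _) (normR_split i x).
    rewrite !(linearB (ccoef c j))/= f0 subr0 => h.
    have h1 : normR (ccoef c j (S i x)) <=
        normR (ccoef c j (S i y)) + e * normR x.
      rewrite -[ccoef c j (S i x)](subKr (ccoef c j (S i y))).
      by rewrite (le_trans (ler_normRB _ _))// lerD2l.
    have := ler_wpM2r (normR_ge0 x) edl; lra.
  have fy : ccoef c j (S i y) != 0.
    apply: contraTneq y1 => ->.
    by rewrite normR0 -leNgt mulr_ge0 ?normR_ge0// divr_ge0 ?ltW.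
  exists ((ccoef c j (S i y))^-1 *: y); split.
  - by rewrite linearZ/= trunc_block0// scaler0.
  - by rewrite linearZ/= trunc_block.
  - by rewrite !linearZ/=; exact: mulVf.
  rewrite normRZV ler_pdivrMr ?toreal_norm_gt0// -ler_pdivrMl ?divr_gt0//.
  rewrite invf_div (le_trans _ (ltW y1))// ler_wpM2l ?divr_ge0 ?(ltW dl0)//.
  by rewrite normR_block.
move=> /choice[x xP].
have xx : normR (\sum_(i < N) x i) <= 2 / dl * N%:R `^ q^-1.
  by apply: (normR_sum_blocks_le (c := d) q1 n_incr) => i; have [] := xP i.
have cross i i' : i != i' -> normR (ccoef c j (S i (x i'))) <= e * (2 / dl).
  have [x0 x1 _ xdl] := xP i'.
  have xb : x i' = block d (n i') (n i'.+1) (x i') by rewrite /block x0 x1 subr0.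
  rewrite neq_ltn => /orP[|] ii.
    rewrite (le_trans (normR_ccoef _ _ _))// (le_trans (normR_late _))//.
      by rewrite xb block_late.
    by rewrite ler_wpM2l.
  by rewrite xb (block_early _ ii) f0 normR0 mulr_ge0// divr_ge0// ltW.
have := normR_sum_diag (h := fun i i' => ccoef c j (S i (x i'))) N cross.
rewrite mulr_ge0 ?divr_ge0 ?(ltW dl0)// => /(_ isT).
rewrite (eq_bigr (fun=> 1)); last by move=> i _; have [] := xP i.
rewrite sumr_const card_ord normR_nat.
under eq_bigr do rewrite -linear_sum -linear_sum /=.
rewrite -linear_sum/= -sum_bop_apply => h.
have N0R : 0 < N%:R :> R by rewrite ltr0n.
have : normR (ccoef c j ((\sum_(i < N) S i) (\sum_(i < N) x i))) <=
    normR (\sum_(i < N) S i) * (2 / dl * N%:R `^ q^-1).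
  rewrite (le_trans (normR_ccoef _ _ _))// (le_trans (ler_opnormR _ _))//.
  by rewrite -normR_bopE ler_wpM2l// normR_ge0.
set s := normR (\sum_(i < N) S i) => h1.
have Nq1 : 1 <= N%:R `^ q^-1 :> R.
  by rewrite -[leLHS](powRr0 N%:R) ler_powR ?ler1n// invr_ge0 ltW// (lt_trans ltr01).
have h2 : N%:R * (N%:R * (e * (2 / dl))) <= 2 / dl * N%:R `^ q^-1.
  have -> : N%:R * (N%:R * (e * (2 / dl))) = e * N%:R ^+ 2 * (2 / dl).
    by rewrite expr2; ring.
  rewrite mulrC ler_wpM2l ?divr_ge0 ?(ltW dl0)//.
  exact: le_trans eN Nq1.
have h3 : N%:R <= 2 / dl * N%:R `^ q^-1 * (s + 1).
  rewrite (le_trans h)// mulrDr mulr1 (le_trans (lerD h1 h2))// mulrC.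
  by rewrite lexx.
rewrite -(ler_pM2r (lt_le_trans ltr01 Nq1)) -(mulrA (dl / 2)).
have -> : N%:R `^ (1 - q^-1) * N%:R `^ q^-1 = N%:R :> R.
  by rewrite -powRD ?(gt_eqF N0R) ?implybT// subrK powRr1// ltW.
rewrite -ler_pdivlMl ?divr_gt0// invf_div (le_trans h3)//.
by rewrite -mulrA [_ * (s + 1)]mulrC.
Qed.

(** The sum is tested on a sum of blocks x_j, of norm at most N^(1/q). The diagonal images are
    almost disjoint of norm at least 1/4, giving N^(1/p) / 4. The 5 collects the error 4eN <= 4 of
    almost disjointness and the cross terms N^2 e <= 1. *)
Lemma lower_diag N : (0 < N)%N -> e <= 8^-1 -> e * N%:R ^+ 2 <= 1 ->
  (forall i, normR (S i) = 1) ->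
  (forall i y, normR (S i (trunc d (n i) y)) <= e * normR y) ->
  (forall i y, normR (trunc c (n i) (S i y)) <= e * normR y) ->
  4^-1 * N%:R `^ (p^-1 - q^-1) <= normR (\sum_(i < N) S i) + 5.
Proof.
move=> N0 e8 eN S1 Sr Sg.
have N0R : 0 < N%:R :> R by rewrite ltr0n.
have N1 : 1 <= N%:R :> R by rewrite ler1n.
have : forall i, exists x, [/\ trunc d (n i) x = 0, trunc d (n i.+1) x = x,
    4^-1 <= normR (S i x) & normR x <= 1].
  move=> i.
  have [x xS] : exists x, 2^-1 * normR x < normR (S i x).
    apply: contrapT => /forallNP Sx.
    have : normR (S i) <= 2^-1.
      rewrite normR_bopE; apply: opnormR_le => // x.
      by have /negP := Sx x; rewrite -leNgt.
    by rewrite S1; lra.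
  have x0 : x != 0.
    by apply: contraTneq xS => ->; rewrite linear0 !normR0 mulr0 ltxx.
  have nx0 := normR_gt0 x0.
  pose y := block d (n i) (n i.+1) x.
  (* Of the factor 1/2 at [x], dropping the early and the late part costs at most 2e <= 1/4. *)
  have y1 : 4^-1 * normR x <= normR (S i y).
    have h := normR_split i x; rewrite -/y in h.
    have h1 : normR (S i x) <= normR (S i y) + (e * normR x + e * normR x).
      have -> : S i x = S i y - ((S i y - (S i x - S i (trunc d (n i) x))) -
          S i (trunc d (n i) x)).
        by rewrite -addrA -opprD subrK subKr.
      rewrite (le_trans (ler_normRB _ _))// lerD2l.
      by rewrite (le_trans (ler_normRB _ _))// lerD.
    have := ler_wpM2r (normR_ge0 x) e8; lra.
  exists (`|x|^-1 *: y); split.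
  - by rewrite linearZ/= trunc_block0// scaler0.
  - by rewrite linearZ/= trunc_block.
  - by rewrite linearZ/= normRZV toreal_norm_id ler_pdivlMr.
  by rewrite normRZV toreal_norm_id ler_pdivrMr// mul1r normR_block.
move=> /choice[x xP].
have xx : normR (\sum_(i < N) x i) <= 1 * N%:R `^ q^-1.
  by apply: (normR_sum_blocks_le (c := d) q1 n_incr) => i; have [] := xP i.
have ele y : normR y <= 1 -> e * normR y <= e by move=> y1; rewrite ler_piMr.
have cross i i' : i != i' -> normR (S i (x i')) <= e.
  have [x0 x1 _ xdl] := xP i'.
  have xb : x i' = block d (n i') (n i'.+1) (x i') by rewrite /block x0 x1 subr0.
  rewrite neq_ltn => /orP[|] ii.
    rewrite (le_trans (normR_late _)) ?ele//.
    by rewrite xb block_late.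
  by rewrite xb (block_early _ ii) (le_trans (Sr _ _))// -xb ele.
have := normR_sum_diag (h := fun i i' => S i (x i')) N cross e0.
have -> : \sum_(i < N) \sum_(j < N) S i (x j) =
    (\sum_(i < N) S i) (\sum_(j < N) x j).
  by rewrite sum_bop_apply; apply: eq_bigr => i _; rewrite linear_sum.
move=> h.
have := @normR_sum_almost_blocks_ge _ _ _ _ c p1 n n_incr N
  (fun i => S i (x i)) 4^-1 e N0 e0.
move=> /(_ _ _ _) h1.
have {}h1 : 4^-1 * N%:R `^ p^-1 <= normR (\sum_(i < N) S i (x i)) + 4 * e * N%:R.
  apply: h1 => i; have [x0 x1 xS xl1] := xP i => //.
    by rewrite (le_trans (Sg _ _))// ele.
  by have := Shi i (x i); rewrite x1 => /le_trans; apply; exact: ele.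
have h2 : normR ((\sum_(i < N) S i) (\sum_(j < N) x j)) <=
    normR (\sum_(i < N) S i) * N%:R `^ q^-1.
  rewrite (le_trans (ler_opnormR _ _))// -normR_bopE ler_wpM2l ?normR_ge0//.
  by rewrite (le_trans xx)// mul1r.
set s := normR (\sum_(i < N) S i) in h2 *.
have Nq1 : 1 <= N%:R `^ q^-1 :> R.
  by rewrite -[leLHS](powRr0 N%:R) ler_powR ?ler1n// invr_ge0 ltW// (lt_trans ltr01).
have eN' : e * N%:R <= 1.
  by rewrite (le_trans _ eN)// ler_wpM2l// expr2 ler_peMr// ltW.
rewrite powRD ?(gt_eqF N0R) ?implybT// powRN mulrA.
rewrite ler_pdivrMr ?(lt_le_trans ltr01 Nq1)// (le_trans h1)//.
have eNN : N%:R * (N%:R * e) = e * N%:R ^+ 2 by rewrite expr2; ring.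
by rewrite eNN in h; rewrite mulrDl; lra.
Qed.

End levels.
End estimates.

(** * Comparison of exponents *)

Lemma linear_subspace0 (R : realType) (k : kind) (V : lmodType (sfield R k))
  (W : set V) : linear_subspace W -> W 0.
Proof. by case=> /set_mem. Qed.

Lemma linear_subspaceP (R : realType) (k : kind) (V : lmodType (sfield R k))
    (W : set V) : linear_subspace W ->
  forall a u v, W u -> W v -> W (a *: u + v).
Proof. by case=> _ WP a u v Wu Wv; apply/set_mem/WP; exact/mem_set. Qed.

Lemma linear_subspace_sum (R : realType) (k : kind) (V : lmodType (sfield R k))
    (W : set V) (I : finType) (u : I -> V) : linear_subspace W ->
  (forall i, W (u i)) -> W (\sum_i u i).
Proof.
move=> sW Wu; elim/big_ind: _ => [|x y Wx Wy|//]; first exact: linear_subspace0.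
by rewrite -[x]scale1r; exact: linear_subspaceP.
Qed.

Section contradiction.
Context {R : realType} {k : kind}.
Local Notation K := (sfield R k).
Context {E F : normedModType K} {p q : R}.
Context (c : coord_system p E) (d : coord_system q F).
Hypotheses (p1 : 1 < p) (pq : p < q).
Let p0 : 0 < p. Proof. exact: lt_trans p1. Qed.
Let q1 : 1 < q. Proof. exact: lt_trans pq. Qed.
Let q0 : 0 < q. Proof. exact: lt_trans q1. Qed.

Context (A B : bop E F) (W : set (bop F E)) (c0 : R).
Local Notation tau S := (bcomp A (bcomp S B)).
Hypotheses (sW : linear_subspace W) (c00 : 0 < c0).
Hypothesis tauW : forall S, W S -> c0 * normR S <= normR (tau S).

Context (G : set_system (bop F E)) {PG : ProperFilter G}.
Hypothesis GW : \forall S \near G, W S /\ normR S = 1.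
Hypothesis GS : forall n, \forall S \near G,
  forall x, trunc c n ((S : bop F E) (trunc d n x)) = 0.
Hypothesis GT : forall n, \forall S \near G,
  forall x, trunc d n (tau S (trunc c n x)) = 0.

(** [P] holds on a set meeting every member of [G]. The failure of [small_columns] or [small_rows]
    provides exactly such a property. *)
Definition frequently (P : bop F E -> Prop) := ~ \forall S \near G, ~ P S.

Lemma frequently_ex P Q : frequently P -> (\forall S \near G, Q S) ->
  exists S, P S /\ Q S.
Proof.
move=> fP nQ; apply: contrapT => /forallNP PQ; apply: fP.
by apply: filterS nQ => S QS PS; exact: (PQ S).
Qed.

Lemma near_frequently P : (\forall S \near G, P S) -> frequently P.
Proof. by move=> nP nN; have [S []] := filter_ex (filterI nP nN). Qed.

Lemma tau_sum N (S : nat -> bop F E) x :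
  tau (\sum_(i < N) S i) x = \sum_(i < N) tau (S i) x.
Proof. by rewrite /= sum_bop_apply linear_sum. Qed.

Lemma tau_bounded : exists2 C : R, 0 <= C &
  forall S y, normR S = 1 -> normR (tau S y) <= C * normR y.
Proof.
have [a a0 Aa] := bop_bounded A; have [b b0 Bb] := bop_bounded B.
exists (a * b); first by rewrite mulr_ge0.
move=> S y S1; rewrite /= (le_trans (Aa _))// -mulrA ler_wpM2l//.
by rewrite (le_trans (ler_opnormR _ _))// -normR_bopE S1 mul1r.
Qed.

(** The gliding hump common to all cases: [ex] is the property from which a case draws its lower
    bound of order N^l, while rows and columns of the composites give an upper bound of order N^mu.
    [N] is fixed before the sequence is built, so [e], [r] and [g] may depend on it. *)
Lemma growth_contradiction (l mu D kap : R)
    (ex : R -> nat -> bop F E -> Prop) (m0 : nat) :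
  0 < kap -> 0 <= mu -> mu < l -> 0 <= D ->
  (forall e n, 0 < e -> frequently (ex e n)) ->
  (forall N, (0 < N)%N -> exists2 e0, 0 < e0 & forall e, 0 < e -> e <= e0 ->
    forall (S : nat -> bop F E) n, (m0 <= n 0%N)%N -> (forall i, (n i <= n i.+1)%N) ->
    (forall i, normR (S i) = 1) ->
    (forall i y, trunc c (n i) (S i (trunc d (n i) y)) = 0) ->
    (forall i y, normR (S i y - trunc c (n i.+1) (S i (trunc d (n i.+1) y))) <=
      e * normR y) ->
    (forall i, ex e (n i) (S i)) ->
    kap * N%:R `^ l <= normR (\sum_(i < N) S i) + 5) ->
  (forall N, (0 < N)%N -> exists r, [/\ 0 <= r, r * N%:R `^ q^-1 <= D * N%:R `^ mu &
    forall n, \forall S \near G, forall y,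
      normR (tau S (trunc c n y)) <= r * normR y]) ->
  (forall N, (0 < N)%N -> exists g, [/\ 0 <= g,
    g * N%:R `^ (1 - p^-1) <= D * N%:R `^ mu &
    forall n, \forall S \near G, forall y,
      normR (trunc d n (tau S y)) <= g * normR y]) ->
  False.
Proof.
move=> kap0 mu0 mul D0 fex lower rows cols.
have [C C0 tauC] := tau_bounded.
(* [C] bounds the diagonal blocks, 1 the error e N, D and 2D the row and column terms; the last term
   comes from the 5 in the lower bound. *)
apply: (@ltr_powR_growth R (c0 * kap) (C + 1 + 3 * D + c0 * 5) l mu) => //.
  by rewrite mulr_gt0.
move=> N N0; have [r [r0 rN rP]] := rows N N0; have [g [g0 gN gP]] := cols N N0.
have [e0 e00 low] := lower N N0.
have N0R : 0 < N%:R :> R by rewrite ltr0n.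
pose e := Num.min e0 N%:R^-1.
have ee0 : 0 < e by rewrite lt_min e00 invr_gt0.
have eN : e * N%:R <= 1 by rewrite -ler_pdivlMr// mul1r ge_min lexx orbT.
have : forall m, exists (S : bop F E) n, (m <= n)%N /\ (ex e m S /\
    [/\ W S /\ normR S = 1,
        (forall x, trunc c m (S (trunc d m x)) = 0) /\
        (forall x, trunc d m (tau S (trunc c m x)) = 0),
        (forall y, normR (tau S (trunc c m y)) <= r * normR y),
        (forall y, normR (trunc d m (tau S y)) <= g * normR y) &
        (forall y, normR (S y - trunc c n (S (trunc d n y))) <= e * normR y) /\
        (forall y, normR (tau S y - trunc d n (tau S (trunc c n y))) <=
           e * normR y)]).
  move=> m.
  have := frequently_ex (fex e m ee0) (filterI GW (filterI (filterI (GS m) (GT m))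
     (filterI (rP m) (gP m)))).
  move=> [S [exS [S1 [S2 [S3 S4]]]]].
  (* The conditions at level [m] select [S]; with [S] known, compactness supplies the upper
     level. *)
  have [n [mn [n1 n2]]] : exists n, (m <= n)%N /\
     ((forall y, normR (S y - trunc c n (S (trunc d n y))) <= e * normR y) /\
        (forall y, normR (tau S y - trunc d n (tau S (trunc c n y))) <=
           e * normR y)).
    apply: (@filter_ex _ \oo); near=> n; split; first by near: n; exact: nbhs_infty_ge.
    split; near: n; first exact: (@pitt _ _ _ _ _ _ c d).
    exact: trunc_approx_sandwich.
  by exists S, n; split => //; split.
move=> /level_chain/(_ m0)[S [n [n0 nS SP]]].
have S1 i : W (S i) /\ normR (S i) = 1 by have [_ []] := SP i.
have {}low : kap * N%:R `^ l <= normR (\sum_(i < N) S i) + 5.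
  apply: (low e ee0 _ S n) => //; first by rewrite ge_min lexx.
  - by rewrite n0.
  - by move=> i; have [] := S1 i.
  - by move=> i; have [_ [_ []]] := SP i.
  - by move=> i; have [_ [_ _ _ _ []]] := SP i.
  - by move=> i; have [] := SP i.
set X := C + e * N%:R + r * N%:R `^ q^-1 + 2 * g * N%:R `^ (1 - p^-1).
have up : normR (tau (\sum_(i < N) S i)) <= X.
  rewrite normR_bopE; apply: opnormR_le.
    by rewrite !addr_ge0// !mulr_ge0// ?powR_ge0// ltW.
  move=> x; rewrite tau_sum.
  apply: (@normR_sum_corners _ _ _ _ _ _ c d p1 pq n nS
    (fun i => tau (S i)) C e r g N x) => // [|i y|i|i|i|i]; first exact: ltW.
  - by apply: tauC; have [] := S1 i.
  - by have [_ [_ []]] := SP i.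
  - by have [_ [_ _ _ _ []]] := SP i.
  - by have [_ []] := SP i.
  - by have [_ []] := SP i.
have {}up : c0 * normR (\sum_(i < N) S i) <= X.
  apply: le_trans up; apply: tauW.
  apply: (@linear_subspace_sum R k _ W _ (fun i : 'I_N => S i) sW) => i.
  by have [] := S1 i.
have Nm1 : 1 <= N%:R `^ mu :> R.
  by rewrite -[leLHS](powRr0 N%:R) ler_powR ?ler1n.
have h1 := ler_wpM2l (ltW c00) low.
have h2 : C + c0 * 5 + 1 <= (C + c0 * 5 + 1) * N%:R `^ mu.
  by rewrite ler_peMr// !addr_ge0// mulr_ge0// ltW.
rewrite -mulrA (le_trans h1)// mulrDr.
move: up; rewrite /X; move: gN rN eN h2.
set s := normR _; set v := N%:R `^ mu; set w := N%:R `^ q^-1.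
set z := N%:R `^ _; nra.
Unshelve. all: by end_near. Qed.

Definition small_columns := forall i (dl : R), 0 < dl ->
  \forall S \near G, normR ((S : bop F E) (cvec d i)) < dl.

Definition small_rows := forall i (dl : R), 0 < dl ->
  \forall S \near G, forall x, normR (ccoef c i ((S : bop F E) x)) <= dl * normR x.

Lemma near_small_columns n (e : R) : small_columns -> 0 < e ->
  \forall S \near G, forall y, normR ((S : bop F E) (trunc d n y)) <= e * normR y.
Proof.
move=> sc e0; have n0 : 0 < n%:R + 1 :> R by rewrite ltr_wpDl.
have : \forall S \near G, forall i : 'I_n,
    normR ((S : bop F E) (cvec d i)) < e / (n%:R + 1).
  by apply: filter_forall => i; apply: sc; rewrite divr_gt0.
apply: filterS => S H x.
have -> : S (trunc d n x) = \sum_(i < n) ccoef d i x *: S (cvec d i).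
  by rewrite linear_sum; apply: eq_bigr => i _; rewrite linearZ.
apply: (@le_trans _ _ (n%:R * (e / (n%:R + 1) * normR x))).
  apply: (@normR_sum_const _ _ _ _ (fun i => ccoef d i x *: S (cvec d i))).
  move=> i ni; rewrite normRZ mulrC ler_pM ?normR_ge0 ?toreal_norm_ge0//.
    exact/ltW/(H (Ordinal ni)).
  exact: normR_ccoef.
rewrite mulrA ler_wpM2r ?normR_ge0// mulrA ler_pdivrMr// mulrC ler_pM2l//.
by rewrite lerDl.
Qed.

Lemma near_small_rows n (e : R) : small_rows -> 0 < e ->
  \forall S \near G, forall y, normR (trunc c n ((S : bop F E) y)) <= e * normR y.
Proof.
move=> sr e0; have n0 : 0 < n%:R + 1 :> R by rewrite ltr_wpDl.
have : \forall S \near G, forall i : 'I_n, forall x,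
    normR (ccoef c i ((S : bop F E) x)) <= e / (n%:R + 1) * normR x.
  by apply: filter_forall => i; apply: sr; rewrite divr_gt0.
apply: filterS => S H x.
rewrite (le_trans (normR_trunc_coef (fun i ni => H (Ordinal ni) x)))//.
rewrite mulrA ler_wpM2r ?normR_ge0// mulrA ler_pdivrMr// mulrC ler_pM2l//.
by rewrite lerDl.
Qed.

(** On the first [n] coordinates [B] has finite rank, so up to a small error its values lie in the
    first [m] coordinates and only [m] columns of [S] are involved. *)
Lemma near_tau_columns n (e : R) : small_columns -> 0 < e ->
  \forall S \near G, forall y, normR (tau S (trunc c n y)) <= e * normR y.
Proof.
move=> sc e0.
have [a a1 Aa] := bop_bounded1 A; have [b b1 Bb] := bop_bounded1 B.
have a0 : 0 < a by rewrite (lt_le_trans _ a1).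
have b0 : 0 < b by rewrite (lt_le_trans _ b1).
have h0 : 0 < e / (2 * a * b) by rewrite divr_gt0// !mulr_gt0.
set h := e / _ in h0.
have [m mP] : exists m, forall y,
    normR (B (trunc c n y) - trunc d m (B (trunc c n y))) <= h * normR y.
  by apply: (@filter_ex _ \oo); exact: near_tail_trunc.
apply: filterS (filterI GW (near_small_columns m sc h0)) => S [[_ S1] Sm] y.
rewrite /= -[B _](subrK (trunc d m (B (trunc c n y)))) (linearD S)/=.
have -> : e * normR y = a * (h * (b * normR y) + h * (b * normR y)).
  by rewrite /h; field; rewrite !gt_eqF.
rewrite (le_trans (Aa _))// ler_pM2l// (le_trans (ler_normRD _ _))// lerD//.
  rewrite (le_trans (ler_opnormR _ _))// -normR_bopE S1 mul1r (le_trans (mP _))//.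
  by rewrite ler_pM2l// ler_peMl ?normR_ge0.
rewrite (le_trans (Sm _))// ler_pM2l// (le_trans (Bb _))// ler_pM2l//.
exact: normR_trunc.
Qed.

(** The first [n] coordinates of [A] almost depend on the first [m] coordinates only, so only [m]
    rows of [S] are involved. *)
Lemma near_tau_rows n (e : R) : small_rows -> 0 < e ->
  \forall S \near G, forall y, normR (trunc d n (tau S y)) <= e * normR y.
Proof.
move=> sr e0.
have [a a1 Aa] := bop_bounded1 A; have [b b1 Bb] := bop_bounded1 B.
have a0 : 0 < a by rewrite (lt_le_trans _ a1).
have b0 : 0 < b by rewrite (lt_le_trans _ b1).
have h0 : 0 < e / (2 * a * b) by rewrite divr_gt0// !mulr_gt0.
set h := e / _ in h0.
have [m mP] : exists m, forall y,
    normR (trunc d n (A (y - trunc c m y))) <= h * normR y.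
  by apply: (@filter_ex _ \oo); exact: near_trunc_tail.
apply: filterS (filterI GW (near_small_rows m sr h0)) => S [[_ S1] Sm] y.
rewrite /= -[S _](subrK (trunc c m (S (B y)))) (linearD A) (linearD (trunc d n))/=.
have -> : e * normR y = h * (b * normR y) * a + a * (h * (b * normR y)).
  by rewrite /h; field; rewrite !gt_eqF.
have Sy : normR (S (B y)) <= b * normR y.
  by rewrite (le_trans (ler_opnormR _ _))// -normR_bopE S1 mul1r.
rewrite (le_trans (ler_normRD _ _))// lerD//.
  rewrite (le_trans (mP _))// -mulrA ler_pM2l// (le_trans Sy)// ler_peMr//.
  by rewrite mulr_ge0 ?normR_ge0// ltW.
rewrite (le_trans (normR_trunc _ q1 _ _))// (le_trans (Aa _))// ler_pM2l//.
by rewrite (le_trans (Sm _))// ler_pM2l.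
Qed.

(** If the columns vanish, r = N^(-1/q) is admissible and cancels the growth; otherwise [r] is the
    uniform bound [C]. All larger [D] are allowed so that one [D] also serves [cols_bound]. *)
Lemma rows_bound (mu : R) : 0 <= mu -> small_columns \/ q^-1 <= mu ->
  exists2 D0, 0 <= D0 & forall D, D0 <= D ->
  (forall N, (0 < N)%N -> exists r, [/\ 0 <= r, r * N%:R `^ q^-1 <= D * N%:R `^ mu &
    forall n, \forall S \near G, forall y,
      normR (tau S (trunc c n y)) <= r * normR y]).
Proof.
move=> mu0 [sc|qmu].
  exists 1 => // D D1 N N0; have N0R : 0 < N%:R :> R by rewrite ltr0n.
  exists (N%:R `^ (- q^-1)); split; first exact: powR_ge0.
    rewrite powRN mulVf ?gt_eqF ?powR_gt0//.
    rewrite -[leLHS]mul1r ler_pM// -[leLHS](powRr0 N%:R) ler_powR ?ler1n//.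
  by move=> n; apply: near_tau_columns => //; rewrite powR_gt0.
have [C C0 tauC] := tau_bounded.
exists C => // D D1 N N0; exists C; split=> //.
  by rewrite ler_pM ?powR_ge0// ler_powR ?ler1n.
move=> n; apply: filterS GW => S [_ S1] y; rewrite (le_trans (tauC _ _ S1))//.
by rewrite ler_wpM2l// normR_trunc.
Qed.

Lemma cols_bound (mu : R) : 0 <= mu -> small_rows \/ 1 - p^-1 <= mu ->
  exists2 D0, 0 <= D0 & forall D, D0 <= D ->
  (forall N, (0 < N)%N -> exists g, [/\ 0 <= g,
    g * N%:R `^ (1 - p^-1) <= D * N%:R `^ mu &
    forall n, \forall S \near G, forall y,
      normR (trunc d n (tau S y)) <= g * normR y]).
Proof.
move=> mu0 [sc|qmu].
  exists 1 => // D D1 N N0; have N0R : 0 < N%:R :> R by rewrite ltr0n.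
  exists (N%:R `^ (- (1 - p^-1))); split; first exact: powR_ge0.
    rewrite powRN mulVf ?gt_eqF ?powR_gt0//.
    rewrite -[leLHS]mul1r ler_pM// -[leLHS](powRr0 N%:R) ler_powR ?ler1n//.
  by move=> n; apply: near_tau_rows => //; rewrite powR_gt0.
have [C C0 tauC] := tau_bounded.
exists C => // D D1 N N0; exists C; split=> //.
  by rewrite ler_pM ?powR_ge0// ler_powR ?ler1n.
move=> n; apply: filterS GW => S [_ S1] y.
by rewrite (le_trans (normR_trunc _ q1 _ _))// tauC.
Qed.

Lemma growth_contradiction_of_exponents (l mu kap : R)
    (ex : R -> nat -> bop F E -> Prop) (m0 : nat) :
  0 < kap -> 0 <= mu -> mu < l ->
  small_columns \/ q^-1 <= mu -> small_rows \/ 1 - p^-1 <= mu ->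
  (forall e n, 0 < e -> frequently (ex e n)) ->
  (forall N, (0 < N)%N -> exists2 e0, 0 < e0 & forall e, 0 < e -> e <= e0 ->
    forall (S : nat -> bop F E) n, (m0 <= n 0%N)%N -> (forall i, (n i <= n i.+1)%N) ->
    (forall i, normR (S i) = 1) ->
    (forall i y, trunc c (n i) (S i (trunc d (n i) y)) = 0) ->
    (forall i y, normR (S i y - trunc c (n i.+1) (S i (trunc d (n i.+1) y))) <=
      e * normR y) ->
    (forall i, ex e (n i) (S i)) ->
    kap * N%:R `^ l <= normR (\sum_(i < N) S i) + 5) ->
  False.
Proof.
move=> kap0 mu0 mul /(rows_bound mu0)[D1 D10 D1P] /(cols_bound mu0)[D2 D20 D2P].
move=> fex low.
apply: (@growth_contradiction l mu (D1 + D2) kap ex m0) => //.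
- by rewrite addr_ge0.
- by apply: D1P; rewrite lerDl.
- by apply: D2P; rewrite lerDr.
Qed.

Let pV1 : p^-1 < 1. Proof. by rewrite invf_lt1. Qed.
Let pV0 : 0 < p^-1. Proof. by rewrite invr_gt0. Qed.
Let qV0 : 0 < q^-1. Proof. by rewrite invr_gt0. Qed.
Let qVp : q^-1 < p^-1. Proof. by rewrite ltf_pV2 ?posrE. Qed.

Lemma tolerance (a : R) N : (0 < N)%N -> 0 < a -> exists2 e0 : R, 0 < e0 &
  forall e, 0 < e -> e <= e0 -> [/\ e <= a, e * N%:R ^+ 2 <= 1 & 4 * e * N%:R <= 4].
Proof.
move=> N0 a0; have N2 : 0 < N%:R ^+ 2 :> R by rewrite exprn_gt0// ltr0n.
have N1 : 1 <= N%:R :> R by rewrite ler1n.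
exists (Num.min a (N%:R ^+ 2)^-1); first by rewrite lt_min a0 invr_gt0.
move=> e e0; rewrite le_min => /andP[ea eN].
have eN2 : e * N%:R ^+ 2 <= 1 by rewrite -ler_pdivlMr// mul1r.
split=> //; rewrite -mulrA -[leRHS]mulr1 ler_pM2l// (le_trans _ eN2)//.
by rewrite ler_pM2l// expr2 ler_peMl// (le_trans ler01).
Qed.

(** Here l = 1/p. The row term has exponent 1/q < 1/p. The column term is either removed by
    [small_rows] or has exponent 1 - 1/p < 1 - 1/q <= 1/p. *)
Lemma contradiction_columns :
  ~ small_columns -> small_rows \/ 1 - q^-1 <= p^-1 -> False.
Proof.
move=> /existsNP[i /existsNP[dl /not_implyP[dl0 ndl]]] sr.
have [mu [mu0 mul qmu srmu]] : exists mu, [/\ 0 <= mu, mu < p^-1, q^-1 <= mu &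
    small_rows \/ 1 - p^-1 <= mu].
  case: sr => [sr|qp]; first by exists q^-1; split => //; [exact: ltW|left].
  exists (Num.max q^-1 (1 - p^-1)); rewrite !le_max !lexx /= (ltW qV0) gt_max qVp orbT.
  by split=> //; [move: pV1 pV0 qV0 qVp; lra|right].
(* Starting at level [i.+1] puts the index [i] inside every corner. *)
apply: (@growth_contradiction_of_exponents p^-1 mu dl
  (fun _ _ S => dl <= normR (S (cvec d i))) i.+1) => //; first by right.
  by move=> e n _; apply: contra_not ndl; apply: filterS => S /negP; rewrite -ltNge.
move=> N N0; have [e0 e00 e0P] := tolerance N0 ltr01; exists e0 => //.
move=> e e_gt0 ee0 S n n0 nS S1 Slo Shi Sex; have [_ _ eN] := e0P _ e_gt0 ee0.
have := lower_column p1 nS (ltW e_gt0) Slo Shi N0 n0 Sex.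
by move=> /le_trans; apply; rewrite lerD2l (le_trans eN)//; lra.
Qed.

(** Here l = 1 - 1/q, which exceeds the column exponent 1 - 1/p. The row term is either removed by
    [small_columns] or has exponent 1/q < 1/p <= 1 - 1/q. *)
Lemma contradiction_rows :
  ~ small_rows -> small_columns \/ p^-1 <= 1 - q^-1 -> False.
Proof.
move=> /existsNP[i /existsNP[dl /not_implyP[dl0 ndl]]] sc.
have [mu [mu0 mul qmu scmu]] : exists mu, [/\ 0 <= mu,
    mu < 1 - q^-1, 1 - p^-1 <= mu & small_columns \/ q^-1 <= mu].
  case: sc => [sc|qp]; first exists (1 - p^-1).
    by split => //; [move: pV1; lra|move: qVp; lra|left].
  exists (Num.max q^-1 (1 - p^-1)); rewrite !le_max !lexx /= (ltW qV0) gt_max.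
  rewrite orbT; split=> //; last by right.
  by apply/andP; split; move: qVp; lra.
apply: (@growth_contradiction_of_exponents (1 - q^-1) mu (dl / 2)
  (fun _ _ S => exists x, dl * normR x < normR (ccoef c i (S x))) i.+1) => //.
- by rewrite divr_gt0.
- by right.
- move=> e n _; apply: contra_not ndl; apply: filterS => S /forallNP H x.
  by have /negP := H x; rewrite -leNgt.
move=> N N0; have dl2 : 0 < dl / 2 by rewrite divr_gt0.
have [e0 e00 e0P] := tolerance N0 dl2; exists e0 => //.
move=> e e_gt0 ee0 S n n0 nS S1 Slo Shi Sex; have [ed eN _] := e0P _ e_gt0 ee0.
have := lower_row p1 pq nS (ltW e_gt0) Slo Shi N0 n0 dl0 ed eN Sex.
by move=> /le_trans; apply; rewrite lerD2l; lra.
Qed.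

(** Both growing terms disappear, so the upper bound has exponent 0, against 1/p - 1/q > 0. *)
Lemma contradiction_diag : small_rows -> small_columns -> False.
Proof.
move=> sr sc.
apply: (@growth_contradiction_of_exponents (p^-1 - q^-1) 0 4^-1 (fun e n S =>
  (forall y, normR (S (trunc d n y)) <= e * normR y) /\
  (forall y, normR (trunc c n (S y)) <= e * normR y)) 0%N) => //.
- by rewrite subr_gt0.
- by left.
- by left.
- move=> e n e0; apply: near_frequently.
  exact: filterI (near_small_columns n sc e0) (near_small_rows n sr e0).
move=> N N0; have a8 : 0 < 8^-1 :> R by rewrite invr_gt0.
have [e0 e00 e0P] := tolerance N0 a8; exists e0 => //.
move=> e e_gt0 ee0 S n n0 nS S1 Slo Shi Sex; have [e8 eN _] := e0P _ e_gt0 ee0.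
by apply: (lower_diag p1 pq nS (ltW e_gt0) Shi N0 e8 eN S1) => i;
  have [] := Sex i.
Qed.

Lemma bounded_below_contradiction : False.
Proof.
have [sc|nsc] := pselect small_columns; have [sr|nsr] := pselect small_rows.
- exact: contradiction_diag.
- by apply: contradiction_rows => //; left.
- by apply: contradiction_columns => //; left.
(* With neither rows nor columns small, the larger of the two lower exponents 1/p and 1 - 1/q
   decides. *)
have [h|h] := leP (1 - q^-1) p^-1.
  by apply: contradiction_columns => //; right.
by apply: contradiction_rows => //; right; exact: ltW.
Qed.

End contradiction.

(** * Coordinates of ell_p *)

Section lp_coord_system.
Context {R : realType} (k : kind) (p : R) (p1 : 1 <= p).
Local Notation K := (sfield R k).
Local Notation E := (lp k p1).
Let p0 : 0 < p. Proof. exact: lt_le_trans p1. Qed.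

Definition lp_coef (i : nat) (x : E) : K^o := x i.
Arguments lp_coef : simpl never.

Lemma lp_coef_is_linear i : linear (lp_coef i).
Proof. by []. Qed.

HB.instance Definition _ i :=
  GRing.isLinear.Build K E K^o *:%R (lp_coef i) (lp_coef_is_linear i).

Lemma powR_normR_lp (x : E) : normR x `^ p = fine (lp_sum p x).
Proof. by rewrite normR_lpE /lp_norm powRVK// fine_ge0// lp_sum_ge0. Qed.

Lemma lp_sumE (x : nat -> K^o) :
  lp_sum p x = (\sum_(0 <= n <oo) (normR (x n) `^ p)%:E)%E.
Proof. by rewrite lp_sum.unlock. Qed.

Lemma powR_coef_ge0 (x : nat -> K^o) n : (0 <= (normR (x n) `^ p)%:E)%E.
Proof. by rewrite lee_fin powR_ge0. Qed.

Definition unit_seq (i : nat) : nat -> K^o := fun j => (i == j)%:R.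

Lemma lp_sum_unit_seq i : lp_sum p (unit_seq i) = 1%E.
Proof.
rewrite lp_sumE (nneseriesD1 (n := i))// => [|n]; last by rewrite lee_fin powR_ge0.
rewrite /unit_seq eqxx normR1 powR1 eseries0 ?adde0// => n _ /andP[_ ni].
by rewrite eq_sym (negbTE ni) normR0 powR0 ?gt_eqF.
Qed.

Lemma unit_seq_lp i : unit_seq i \in lp_pred k p.
Proof. by apply/asboolP; rewrite lp_sum_unit_seq ltry. Qed.

Definition lp_vec i : E := Lp p1 (unit_seq_lp i).

Lemma lp_coef_vec i j : lp_coef i (lp_vec j) = (i == j)%:R.
Proof. by rewrite eq_sym. Qed.

Lemma normR_lp_vec i : normR (lp_vec i) <= 1.
Proof.
apply: (ler_of_powR p0); rewrite ?normR_ge0//.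
by rewrite powR_normR_lp lp_sum_unit_seq powR1.
Qed.

Lemma normR_lp_coef i (x : E) : normR (lp_coef i x) <= normR x.
Proof.
apply: (ler_of_powR p0); rewrite ?normR_ge0// powR_normR_lp -lee_fin.
rewrite fineK ?lp_sum_fin// lp_sumE (nneseriesD1 (n := i))//.
  by rewrite leeDl// nneseries_ge0// => n _ _; rewrite lee_fin powR_ge0.
by move=> n; rewrite lee_fin powR_ge0.
Qed.

Lemma lp_partialE n (x : E) (j : nat) :
  (\sum_(i < n) lp_coef i x *: lp_vec i : E) j = if (j < n)%N then x j else 0.
Proof.
rewrite -[LHS]/(lp_coef j _) linear_sum/=.
have [jn|nj] := ltnP j n.
  rewrite (bigD1 (Ordinal jn))//= linearZ/= lp_coef_vec eqxx.
  rewrite big1 ?addr0 => [|i ij]; first exact: mulr1.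
  have /negbTE ji : j != i by apply: contra_neq ij => ij; apply/val_inj.
  by rewrite linearZ/= lp_coef_vec ji scaler0.
rewrite big1// => i _; rewrite linearZ/= lp_coef_vec gtn_eqF ?scaler0//.
exact: leq_trans (ltn_ord i) nj.
Qed.

Lemma lp_remainderE n (x : E) (j : nat) :
  (x - \sum_(i < n) lp_coef i x *: lp_vec i : E) j = if (j < n)%N then 0 else x j.
Proof.
rewrite -[LHS]/(lp_coef j _) linearB/= /lp_coef lp_partialE.
by case: ifP => _; rewrite ?subrr ?subr0.
Qed.

Lemma powR_normR_lp_split n (x : E) : normR x `^ p =
  normR (\sum_(i < n) lp_coef i x *: lp_vec i) `^ p +
  normR (x - \sum_(i < n) lp_coef i x *: lp_vec i) `^ p.
Proof.
rewrite !powR_normR_lp; apply: EFin_inj; rewrite EFinD !fineK ?lp_sum_fin// !lp_sumE.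
rewrite -nneseriesD; try by move=> i _ _; by rewrite lee_fin powR_ge0.
apply: eq_eseriesr => j _; rewrite lp_partialE lp_remainderE.
by case: ifP => _; rewrite normR0 powR0 ?gt_eqF// ?adde0 ?add0e.
Qed.

(** The p-th power of the remainder's norm is the tail of a convergent series. *)
Lemma lp_partial_cvg (x : E) (e : R) : 0 < e -> exists n0, forall n, (n0 <= n)%N ->
  normR (x - \sum_(i < n) lp_coef i x *: lp_vec i) <= e.
Proof.
move=> e0.
have xoo : (\sum_(0 <= n <oo | true) (normR (x n) `^ p)%:E < +oo)%E.
  by rewrite -lp_sumE -ge0_fin_numE ?lp_sum_fin ?lp_sum_ge0.
have := nneseries_tail_cvg xoo (fun n _ => powR_coef_ge0 x n).
move=> /fine_cvg/cvgrPdist_lt/(_ _ (powR_gt0 p e0))[n0 _ n0P].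
exists n0 => n /n0P /=; rewrite sub0r normrN => nP.
apply: (ler_of_powR p0); rewrite ?normR_ge0 ?(ltW e0)//.
apply: le_trans (ltW nP); rewrite powR_normR_lp lp_sumE.
apply: le_trans (ler_norm _) _; rewrite le_eqVlt; apply/orP; left; apply/eqP.
congr (`|fine _|); rewrite [RHS]eseries_cond [RHS]eseries_mkcond.
apply: eq_eseriesr => j _; rewrite lp_remainderE.
by case: leqP => _ //=; rewrite normR0 powR0 ?gt_eqF.
Qed.

Definition lp_coord_system : coord_system p E :=
  CoordSystem lp_coef_vec normR_lp_vec normR_lp_coef powR_normR_lp_split
    lp_partial_cvg.

End lp_coord_system.

(** * Infinite-dimensional spaces of operators *)

Section infinite_dimension.
Context {R : realType} {k : kind}.
Local Notation K := (sfield R k).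

(** A finite spanning family of the kernel together with one vector [v0] where [g] does not vanish
    would span [W]. *)
Lemma infinite_dimensional_kernel (V : lmodType K) (W : set V)
    (g : {linear V -> K^o}) : linear_subspace W -> ~ finite_dimensional W ->
  linear_subspace (W `&` [set v | g v = 0]) /\
  ~ finite_dimensional (W `&` [set v | g v = 0]).
Proof.
move=> sW infW; split.
  split; first by apply/mem_set; split; [exact: linear_subspace0|exact: linear0].
  move=> a u v /set_mem[Wu gu] /set_mem[Wv gv]; apply/mem_set.
  split; first exact: linear_subspaceP.
  by rewrite /= linearP gu gv scaler0 addr0.
move=> [n [b [Wb bW]]]; apply: infW.
have [[v0 [Wv0 gv0]]|H] := pselect (exists v0, W v0 /\ g v0 != 0); last first.
  exists n, b; split=> [i|v Wv]; first by have [] := Wb i.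
  apply: bW; split => //; apply/eqP/negPn/negP => gv.
  by apply: H; exists v.
exists n.+1, (fun i => if unlift ord0 i is Some j then b j else v0).
split=> [i|v Wv].
  by case: unliftP => [j _|_] //; have [] := Wb j.
have [|c vc] := bW (v - (g v / g v0) *: v0).
  split.
    by rewrite addrC -scaleNr; exact: linear_subspaceP.
  by rewrite /= linearB linearZ/= -[X in _ - X]/(g v / g v0 * g v0) divfK// subrr.
exists (fun i => if unlift ord0 i is Some j then c j else g v / g v0).
rewrite big_ord_recl unlift_none.
under eq_bigr do rewrite liftK.
by rewrite -vc subrKC.
Qed.

Lemma infinite_dimensional_kernels (V : lmodType K) (s : seq {linear V -> K^o})
    (W : set V) : linear_subspace W -> ~ finite_dimensional W ->
  exists v, [/\ W v, v != 0 & all (fun g : {linear V -> K^o} => g v == 0) s].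
Proof.
elim: s W => [|g s IH] W sW infW.
  apply: contrapT => H; apply: infW; exists 0%N, (fun=> 0); split=> [[]//|v Wv].
  exists (fun=> 0); rewrite big_ord0; apply/eqP/negPn/negP => v0.
  by apply: H; exists v.
have [sWg infWg] := infinite_dimensional_kernel g sW infW.
have [v [[Wv gv] v0 vs]] := IH _ sWg infWg.
by exists v; split => //=; rewrite vs andbT; apply/eqP.
Qed.

(* Generated by the unit spheres of the subspaces of finite codimension in [W]. *)
Definition cofinite_sphere (V : normedModType K) (W : set V) : set_system V :=
  fun P => exists s : seq {linear V -> K^o}, forall v, W v -> normR v = 1 ->
    all (fun g : {linear V -> K^o} => g v == 0) s -> P v.

(** Intersections correspond to concatenated lists. Properness holds since finitely many functionals
    have a common nonzero zero in [W], which can be normalized. *)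
Lemma cofinite_sphere_filter (V : normedModType K) (W : set V) :
  linear_subspace W -> ~ finite_dimensional W ->
  ProperFilter (cofinite_sphere W).
Proof.
move=> sW infW; apply: Build_ProperFilter_ex.
  move=> P [s sP]; have [v [Wv v0 vs]] := infinite_dimensional_kernels s sW infW.
  exists (`|v|^-1 *: v); apply: sP.
  - by rewrite -[X in W X]addr0; apply: linear_subspaceP => //; exact: linear_subspace0.
  - by rewrite normRZV toreal_norm_id divff// gt_eqF// normR_gt0.
  - by apply: sub_all vs => g /eqP gv; rewrite linearZ/= gv scaler0.
split.
- by exists [::].
- move=> P Q [s sP] [t tQ]; exists (s ++ t) => v Wv v1; rewrite all_cat.
  by move=> /andP[vs vt]; split; [exact: sP|exact: tQ].
- by move=> P Q PQ [s sP]; exists s => v Wv v1 vs; exact/PQ/sP.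
Qed.

Lemma near_sphere (V : normedModType K) (W : set V) :
  \forall v \near cofinite_sphere W, W v /\ normR v = 1.
Proof. by exists [::]. Qed.

Lemma near_linear_eq0 (V : normedModType K) (W : set V) (g : V -> K^o) :
  linear g -> \forall v \near cofinite_sphere W, g v = 0.
Proof.
move=> lg; pose gl := GRing.isLinear.Build K V K^o *:%R g lg.
pose g' : {linear V -> K^o} := HB.pack g gl.
by exists [:: g'] => v _ _ /=; rewrite andbT => /eqP.
Qed.

(** A corner of size [n] has n^2 matrix entries, each a linear functional of [v]. *)
Lemma near_corner0 (V : normedModType K) (W : set V) (E F : normedModType K)
    (p q : R) (c : coord_system p E) (d : coord_system q F)
    (f : V -> bop E F) (n : nat) :
  linear_subspace W -> ~ finite_dimensional W -> linear f ->
  \forall v \near cofinite_sphere W, forall x,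
    trunc d n (f v (trunc c n x)) = 0.
Proof.
move=> sW infW lf; have PG := cofinite_sphere_filter sW infW.
have : \forall v \near cofinite_sphere W, forall i j : 'I_n,
    ccoef d i (f v (cvec c j)) = 0.
  apply: filter_forall => i; apply: filter_forall => j.
  apply: (@near_linear_eq0 _ _ (fun v => ccoef d i (f v (cvec c j)))).
  by move=> a u v; rewrite lf -[_ (cvec c j)]/(a *: f u _ + f v _) linearP.
apply: filterS => v H x; rewrite [trunc c n x]/trunc linear_sum linear_sum.
rewrite big1// => j _; rewrite linearZ linearZ /=.
rewrite [trunc d n _]/trunc big1 ?scaler0// => i _.
by rewrite H scale0r.
Qed.

End infinite_dimension.

(** * Reduction to operators between ell_p and ell_q *)

Section reduction.
Context {R : realType} {k : kind}.
Local Notation K := (sfield R k).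

Lemma sandwich_bounded_below_finite_dimensional
    (E F : normedModType K) (p q : R) (c : coord_system p E)
    (d : coord_system q F) (A B : bop E F) (W : set (bop F E)) (e : R) :
  1 < p -> p < q -> linear_subspace W -> 0 < e ->
  (forall S, W S -> e * normR S <= normR (bcomp A (bcomp S B))) ->
  finite_dimensional W.
Proof.
move=> p1 pq sW e0 WP; apply: contrapT => infW.
have PG := cofinite_sphere_filter sW infW.
apply: (@bounded_below_contradiction _ _ _ _ _ _ c d p1 pq A B W e sW e0 WP
  (cofinite_sphere W)).
- exact: near_sphere.
- by move=> n; apply: (near_corner0 d c n (f := id) sW infW).
move=> n; apply: (near_corner0 c d n (f := fun S => bcomp A (bcomp S B)) sW infW).
move=> a S T; by apply: bopP => x; exact: (bop_linear A).
Qed.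

(** Continuity of the inverse at 0 with tolerance 1 gives the constant: a unit vector of [V] with a
    smaller image would be sent back to a vector of norm less than 1. *)
Lemma isomorphism_bounded_below (E F : normedModType K) (S : bop E F) (V : set E) :
  linear_subspace V -> isomorphism_onto_range S V ->
  exists2 e : R, 0 < e & forall x, V x -> e * normR x <= normR (S x).
Proof.
move=> sV [g [gS /subspace_continuousP gc]].
have V0 := linear_subspace0 sV.
have S0 : (S @` V) 0 by exists 0 => //; exact: linear0.
have g0 : g 0 = 0 by rewrite -[X in g X](linear0 S) gS.
have /cvgrPdist_lt/(_ _ (@ltr01 K)) := gc _ S0.
move=> /nbhs_ballP[dl /= dl0 dlP].
have tdl : 0 < toreal dl by rewrite -(@ltr_ofreal _ k) torealK ?ofreal0// ltW.
exists (toreal dl) => // x Vx; rewrite leNgt; apply/negP => Sx.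
have x0 : x != 0 by apply: contraTneq Sx => ->; rewrite normR0 mulr0 -leNgt normR_ge0.
pose y := `|x|^-1 *: x.
have Vy : V y by rewrite /y -[X in V X]addr0; exact: linear_subspaceP.
have Sy : `|S y| < dl.
  rewrite -ofreal_normR -[dl]torealK ?(ltW dl0)// ltr_ofreal /y linearZ/= normRZV.
  by rewrite toreal_norm_id ltr_pdivrMr// normR_gt0.
have : `|g 0 - g (S y)| < 1.
  apply: (dlP (S y)); last by exists y.
  by rewrite -ball_normE /= sub0r normrN.
by rewrite g0 gS// sub0r normrN /y normrZ normfV normr_id mulVf ?normr_eq0// ltxx.
Qed.

End reduction.

(** ATB - A'TB' = (A - A')TB + A'T(B - B'), and A' has norm at most a + 1. *)
Lemma mulop_approximation (R : realType) (k : kind)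
    (X : normedModType (sfield R k)) (A B A' B' T : bop X X) (a b dl : R) :
  0 <= a -> 0 <= b -> 0 <= dl -> dl <= 1 ->
  (forall x, normR (A x) <= a * normR x) ->
  (forall x, normR (B x) <= b * normR x) ->
  normR (A - A') <= dl -> normR (B - B') <= dl ->
  normR (bcomp A (bcomp T B) - bcomp A' (bcomp T B')) <=
    (a + b + 1) * dl * normR T.
Proof.
move=> a0 b0 dl0 dl1 Aa Bb AA BB; have T0 := normR_ge0 T.
rewrite normR_bopE; apply: opnormR_le => [|x].
  by rewrite !mulr_ge0// !addr_ge0.
have x0 := normR_ge0 x.
have opP (S : bop X X) (m : R) y :
    normR S <= m -> normR (S y) <= m * normR y.
  move=> Sm; rewrite (le_trans (ler_opnormR _ _))// -normR_bopE.
  by rewrite ler_wpM2r ?normR_ge0.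
have A'a u : normR (A' u) <= (a + 1) * normR u.
  have -> : A' u = A u - (A - A') u by rewrite -[(A - A') u]/(A u - A' u) subKr.
  rewrite (le_trans (ler_normRB _ _))// mulrDl lerD// opP// (le_trans AA)//.
have -> : (bcomp A (bcomp T B) - bcomp A' (bcomp T B')) x =
    (A - A') (T (B x)) + A' (T ((B - B') x)).
  rewrite -[LHS]/(A (T (B x)) - A' (T (B' x))).
  rewrite -[(A - A') _]/(A (T (B x)) - A' (T (B x))) -[(B - B') x]/(B x - B' x).
  by rewrite (linearB T) (linearB A')/= subrKA.
have h1 : normR ((A - A') (T (B x))) <= dl * (normR T * (b * normR x)).
  rewrite (le_trans (opP _ _ _ AA))// ler_wpM2l//.
  by rewrite (le_trans (opP _ _ _ (lexx _)))// ler_wpM2l.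
have h2 : normR (A' (T ((B - B') x))) <= (a + 1) * (normR T * (dl * normR x)).
  rewrite (le_trans (A'a _))// ler_wpM2l ?addr_ge0//.
  by rewrite (le_trans (opP _ _ _ (lexx _)))// ler_wpM2l// opP.
by rewrite (le_trans (ler_normRD _ _))// (le_trans (lerD h1 h2))//; lra.
Qed.

Theorem theorem5p7 (R : realType) (k : kind)
    (X : completeNormedModType (sfield R k)) (A B : bop X X)
    (p q : R) (p1 : 1 < p) (pq : p < q) :
  approx_factorizable (ltW p1) pq A ->
  approx_factorizable (ltW p1) pq B ->
  strictly_singular (mulop A B).
Proof.
move=> fA fB V sV infV /(isomorphism_bounded_below sV)[e e0 eP]; apply: infV.
have [a a1 Aa] := bop_bounded1 A; have [b b1 Bb] := bop_bounded1 B.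
have a0 : 0 < a by rewrite (lt_le_trans ltr01).
have b0 : 0 < b by rewrite (lt_le_trans ltr01).
have ab0 : 0 < 2 * (a + b + 1) by rewrite mulr_gt0// !addr_gt0// (lt_le_trans ltr01).
(* Replacing [A] and [B] by factorizations within [dl] then costs at most half of the lower bound
   [e]. *)
pose dl := Num.min 1 (e / (2 * (a + b + 1))).
have dl0 : 0 < dl by rewrite lt_min ltr01 divr_gt0.
have dl1 : dl <= 1 by rewrite ge_min lexx.
have dle : (a + b + 1) * dl <= e / 2.
  have : dl <= e / (2 * (a + b + 1)) by rewrite ge_min lexx orbT.
  by rewrite ler_pdivlMr//; lra.
have [A1 [A2 [A3 Adl]]] := fA _ dl0; have [B1 [B2 [B3 Bdl]]] := fB _ dl0.
have [a3 a31 A3P] := bop_bounded1 A3; have [b1' b11 B1P] := bop_bounded1 B1.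
have [a1' a11 A1P] := bop_bounded1 A1; have [b3 b31 B3P] := bop_bounded1 B3.
have a30 : 0 < a3 by rewrite (lt_le_trans ltr01).
have b10 : 0 < b1' by rewrite (lt_le_trans ltr01).
have a10 : 0 < a1' by rewrite (lt_le_trans ltr01).
have b30 : 0 < b3 by rewrite (lt_le_trans ltr01).
(* [Phi] turns operators on [X] into operators from ell_q to ell_p, and the product of the two
   factorizations around [T] is A3 (tau (Phi T)) B1. *)
pose Phi T := bcomp A1 (bcomp T B3).
pose tau S := bcomp A2 (bcomp S B2).
have PhiL : linear Phi by move=> s S T; apply: bopP => x; exact: (bop_linear A1).
have tauP T : V T -> e / 2 * normR T <= a3 * b1' * normR (tau (Phi T)).
  move=> VT.
  have h1 := eP _ VT.
  have h2 := mulop_approximation T (ltW a0) (ltW b0) (ltW dl0) dl1 Aa Bb Adl Bdl.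
  set U := bcomp _ (bcomp T (bcomp B3 _)) in h2.
  have h3 : normR U <= a3 * b1' * normR (tau (Phi T)).
    rewrite normR_bopE; apply: opnormR_le => [|x].
      by rewrite !mulr_ge0 ?normR_ge0// ltW.
    rewrite [U x]/(A3 (tau (Phi T) (B1 x))) (le_trans (A3P _))// -!mulrA ler_pM2l//.
    rewrite (le_trans (ler_opnormR (tau (Phi T)) _))// -normR_bopE mulrCA.
    by rewrite ler_wpM2l ?normR_ge0.
  have h4 : normR (mulop A B T) <=
      normR (bcomp A (bcomp T B) - U) + normR U.
    by rewrite -[mulop A B T](subrK U) ler_normRD.
  have := ler_wpM2r (normR_ge0 T) dle; lra.
have PhiP T : normR (Phi T) <= a1' * b3 * normR T.
  rewrite normR_bopE; apply: opnormR_le => [|x].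
    by rewrite !mulr_ge0 ?normR_ge0// ltW.
  rewrite /= (le_trans (A1P _))// -!mulrA ler_pM2l// (le_trans (ler_opnormR _ _))//.
  by rewrite -normR_bopE mulrCA ler_wpM2l ?normR_ge0.
pose W := Phi @` V.
have sW : linear_subspace W.
  split.
    apply/mem_set; exists 0; first exact: linear_subspace0.
    by apply: bopP => x; exact: linear0.
  move=> s _ _ /set_mem[S VS <-] /set_mem[T VT <-]; apply/mem_set.
  by exists (s *: S + T); [exact: linear_subspaceP|rewrite PhiL].
(* [C] combines [tauP] with the bound [PhiP], so that [tau] is bounded below by e / 2 / C on [W]. *)
pose C := a3 * b1' * (a1' * b3).
have C0 : 0 < C by rewrite !mulr_gt0.
have fW : finite_dimensional W.
  apply: (@sandwich_bounded_below_finite_dimensional _ _ _ _ _ _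
    (lp_coord_system k (ltW p1))
    (lp_coord_system k (le_trans (ltW p1) (ltW pq))) A2 B2 W (e / 2 / C) p1 pq sW).
    by rewrite !divr_gt0.
  move=> _ [T VT <-]; rewrite mulrAC ler_pdivrMr//.
  have := ler_wpM2l (ltW (divr_gt0 e0 (ltr0n _ 2))) (PhiP T).
  have := ler_wpM2l (ltW (mulr_gt0 a10 b30)) (tauP _ VT).
  rewrite /C -/(tau (Phi T)); lra.
(* By [tauP], [Phi] is injective on [V], so preimages of a spanning family of [W] span [V]. *)
have [n [u [uW uP]]] := fW.
have /choice[v vP] : forall i, exists T, V T /\ Phi T = u i.
  by move=> i; have [T VT TE] := uW i; exists T.
exists n, v; split=> [i|T VT]; first by have [] := vP i.
have [s sE] := uP _ (ex_intro2 _ _ T VT erefl); exists s.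
pose D := T - \sum_(i < n) s i *: v i.
have sV0 := linear_subspace0 sV.
have VD : V D.
  rewrite /D addrC -scaleN1r; apply: linear_subspaceP => //.
  apply: linear_subspace_sum => // i; rewrite -[_ *: _]addr0.
  by apply: linear_subspaceP => //; have [] := vP i.
have PhiD : Phi D = 0.
  pose Phil : {linear bop X X -> _} :=
    HB.pack Phi (GRing.isLinear.Build _ _ _ _ Phi PhiL).
  rewrite -[Phi]/(Phil : _ -> _) linearB linear_sum /= sE; apply/eqP.
  rewrite subr_eq0; apply/eqP/eq_bigr => i _.
  by have [_ <-] := vP i; exact/esym/(linearZ_LR Phil).
have D0 : D = 0.
  apply/normR0_eq0/eqP; rewrite eq_le normR_ge0 andbT.
  have := tauP _ VD; rewrite PhiD.
  have -> : tau 0 = 0 by apply: bopP => x; exact: linear0.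
  by rewrite normR0 mulr0 pmulr_rle0// divr_gt0.
by apply/eqP; rewrite -subr_eq0 -/D D0.
Qed.
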